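(* Let $(H_n)_{n\in\mathbb N}$ be a sequence of Hilbert spaces, let $\boldsymbol y=(y_n)_{n\in\mathbb N}\in\times_{n\in\mathbb N}H_n$ be a $C_0$-sequence, and let $\mathcal T_n=(T_n(t))_{t\ge0}\subset\mathcal L(H_n)$ be a $C_0$-semigroup for each $n\in\mathbb N$. Then the following are equivalent. (a) $\bigotimes_{n\in\mathbb N}^{\boldsymbol y}\mathcal T_n\subset\mathcal L\bigl(\bigotimes_{n\in\mathbb N}^{\boldsymbol y}H_n\bigr)$ is a $C_0$-semigroup. (b) There exists $\tau>0$ such that $\bigotimes_{n\in\mathbb N}^{\boldsymbol y}T_n(t)\in\mathcal L\bigl(\bigotimes_{n\in\mathbb N}^{\boldsymbol y}H_n\bigr)\setminus\{0\}$ for all $t\in[0,\tau]$, and $\limsup_{t\to0^+}\bigl\|\bigotimes_{n\in\mathbb N}^{\boldsymbol y}T_n(t)\bigr\|<\infty$. (c) There exist $\tau>0$ and $M>0$ such that, for all $t\in[0,\tau]$: (i) $T_n(t)\ne0$ for each $n\in\mathbb N$; (ii) $\prod_{n\in\mathbb N}\|T_n(t)\|\le M$; and (iii) $\sum_{n\in\mathbb N}|1-\langle T_n(t)y_n,y_n\rangle|<\infty$.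
   Context: Hilbert spaces are complex; $\mathcal L(H)$ denotes the bounded operators on $H$. Products: for $(z_n)\subset\mathbb C$, $\prod_nz_n$ converges unconditionally to $a\in\mathbb C$ if $\lim_{N\to\infty}\prod_{n=1}^Nz_{\sigma(n)}=a$ for every bijection $\sigma:\mathbb N\to\mathbb N$. Infinite products (including the one in (c)(ii)) are understood to converge unconditionally. $\prod_nz_n$ is quasi-convergent if $\prod_n|z_n|$ converges unconditionally to a finite value; its value is then the unconditional limit of $\prod_nz_n$ if it exists and $0$ otherwise. Tensor products: $(h_n)\in\times_nH_n$ is a $C$-sequence if $\prod_n\|h_n\|$ converges unconditionally to a finite value. For a $C$-sequence $(h_n)$ the elementary tensor $\bigotimes_nh_n$ is the functional $(f_n)\mapsto\prod_n\langle h_n,f_n\rangle$ (quasi-convergent product) on the set of $C$-sequences. The complete tensor product $\bigotimes_nH_n$ is the completion of the linear span of elementary tensors with inner product determined by $\langle\bigotimes_nh_n,\bigotimes_nf_n\rangle=\prod_n\langle h_n,f_n\rangle$. A $C$-sequence is a $C_0$-sequence if $\sum_n|1-\|h_n\||<\infty$; two $C_0$-sequences are equivalent if $\sum_n|1-\langle h_n,f_n\rangle|<\infty$ (an equivalence relation). For a $C_0$-sequence $\boldsymbol y$, the incomplete tensor product $\bigotimes_n^{\boldsymbol y}H_n$ is the closed linear span in $\bigotimes_nH_n$ of the $\bigotimes_nh_n$ with $(h_n)$ a $C_0$-sequence equivalent to $\boldsymbol y$. For $A_n\in\mathcal L(H_n)$, $\bigotimes_n^{\boldsymbol y}A_n$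 is well-defined (factorwise sense), written $\bigotimes_n^{\boldsymbol y}A_n\in\mathcal L(\bigotimes_n^{\boldsymbol y}H_n)$, if for every elementary tensor $\bigotimes_nh_n\in\bigotimes_n^{\boldsymbol y}H_n$, $\bigotimes_nA_nh_n$ is an elementary tensor in $\bigotimes_n^{\boldsymbol y}H_n$, and $\bigotimes_nh_n\mapsto\bigotimes_nA_nh_n$ extends linearly to a bounded operator on $\bigotimes_n^{\boldsymbol y}H_n$. The family $\bigotimes_n^{\boldsymbol y}\mathcal T_n:=(\bigotimes_n^{\boldsymbol y}T_n(t))_{t\ge0}$ is formed pointwise in $t$. A $C_0$-semigroup is a semigroup that is strongly continuous on $[0,\infty)$.
   Formalization: Every Hilbert space H_n is assumed to be nonzero; if some H_n = {0}, the incomplete tensor product is {0}, so (a) holds while (b) and (c)(i) fail, and the stated equivalence is false. *)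

(* Defs.v *)
From HB Require Import structures.
From mathcomp Require Import all_boot all_order all_algebra.
From mathcomp Require Import all_classical all_reals all_analysis.
From mathcomp Require Import complex.

Set Implicit Arguments.
Unset Strict Implicit.
Unset Printing Implicit Defensive.

Import Order.TTheory GRing.Theory Num.Theory.
Import numFieldNormedType.Exports.

Local Open Scope classical_set_scope.
Local Open Scope complex_scope.
Local Open Scope ring_scope.

(* Complex Hilbert spaces.  [{dot H for Num.conj}] is linear in its first
   argument and conjugate-linear in the second.  Norms take values in R[i];
   [complex.Re `|x|] is the norm as an element of R. *)
HB.mixin Record isHilbert (R : realType) H & CompleteNormedModule R[i] H := {
  inner : {dot H for (@Num.conj R[i])} ;
  inner_norm : forall x : H, inner x x = `|x| ^+ 2
}.

#[short(type="hilbertType")]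
HB.structure Definition Hilbert (R : realType) :=
  {H of CompleteNormedModule R[i] H & isHilbert R H}.

Definition lin_span (K : nzRingType) (V : lmodType K) (S : set V) : set V :=
  [set x | exists n (c : 'I_n -> K) (s : 'I_n -> V),
     (forall i, S (s i)) /\ x = \sum_i c i *: s i].

Lemma lin_span_linear (K : nzRingType) (V : lmodType K) (S : set V)
    (c : K) (x y : V) :
  lin_span S x -> lin_span S y -> lin_span S (c *: x + y).
Proof.
move=> [n [a [s [Ss ->]]]] [m [b [t [St ->]]]].
exists (n + m)%N,
  (fun i : 'I_(n + m) =>
     match fintype.split i with inl j => c * a j | inr j => b j end),
  (fun i : 'I_(n + m) =>
     match fintype.split i with inl j => s j | inr j => t j end); split.
  by move=> i; case: (fintype.split i).
rewrite big_split_ord scaler_sumr; congr (_ + _); apply: eq_bigr => i _.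
  by case: split_ordP => [j /lshift_inj <-|j /esym/eqP]; rewrite ?scalerA// eq_rlshift.
by case: split_ordP => [j /eqP|j /rshift_inj <-//]; rewrite eq_rlshift.
Qed.

Section closed_span.
Variables (R : realType) (V : hilbertType R) (S : set V).

Definition closed_span : {pred V} := mem (closure (lin_span S)).

Lemma closed_spanP (x : V) :
  reflect (forall e : R[i], 0 < e -> exists2 u, lin_span S u & `|x - u| < e)
          (x \in closed_span).
Proof.
apply: (iffP idP) => [|xS].
  rewrite inE => xS e e0.
  have [u [Su xu]] := xS _ (nbhsx_ballx x e e0).
  by exists u => //; move: xu; rewrite -ball_normE.
rewrite inE => B /nbhs_ballP[e /= e0 xB].
have [u Su xu] := xS _ e0; exists u; split=> //; apply: xB.
by rewrite -ball_normE.
Qed.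

Fact closed_span_submod : submod_closed closed_span.
Proof.
split=> [|c x y /closed_spanP xS /closed_spanP yS].
  apply/closed_spanP => e e0; exists 0; last by rewrite subrr normr0.
  by exists 0%N, (fun=> 0), (fun=> 0); split=> [[]//|]; rewrite big_ord0.
apply/closed_spanP => e e0.
have c0 : 0 < `|c| + 1 by rewrite ltr_wpDl.
have e2 : 0 < e / 2 by rewrite divr_gt0.
have [u Su xu] := xS _ (divr_gt0 e2 c0).
have [v Sv yv] := yS _ e2.
exists (c *: u + v); first exact: lin_span_linear.
rewrite opprD addrACA -scalerBr (le_lt_trans (ler_normD _ _))//.
rewrite [e]splitr ltrD// normrZ (@le_lt_trans _ _ ((`|c| + 1) * `|x - u|))//.
  by rewrite ler_wpM2r// lerDl.
by rewrite mulrC -ltr_pdivlMr.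
Qed.

HB.instance Definition _ :=
  GRing.isSubmodClosed.Build R[i] V closed_span closed_span_submod.

(* The closed linear span of [S] as a Hilbert space of its own; [val] is the
   inclusion into [V]. *)
Definition closed_span_space : Type := {x : V | x \in closed_span}.
HB.instance Definition _ := [isSub of closed_span_space for @sval _ _].
HB.instance Definition _ := [Choice of closed_span_space by <:].
HB.instance Definition _ := [SubChoice_isSubLmodule of closed_span_space by <:].

Let norm (x : closed_span_space) : R[i] := `|val x|.

Fact closed_span_normD x y : norm (x + y) <= norm x + norm y.
Proof. by rewrite /norm raddfD ler_normD. Qed.

Fact closed_span_normZ (c : R[i]) x : norm (c *: x) = `|c| * norm x.
Proof. by rewrite /norm linearZ/= normrZ. Qed.

Fact closed_span_norm_eq0 x : norm x = 0 -> x = 0.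
Proof. by move/normr0_eq0 => x0; apply: val_inj; rewrite raddf0. Qed.

HB.instance Definition _ := Lmodule_isNormed.Build R[i] closed_span_space
  closed_span_normD closed_span_normZ closed_span_norm_eq0.

Lemma closed_span_normE (x : closed_span_space) : `|x| = `|val x|.
Proof. by []. Qed.

Fact closed_span_complete (F : set_system closed_span_space) :
  ProperFilter F -> cauchy F -> cvg F.
Proof.
move=> FF Fc.
have vc : cauchy (val @ F).
  apply/cauchy_ballP => e e0.
  have /cauchy_ballP/(_ e e0) := Fc.
  move=> [[A B] /= [FA FB] AB].
  exists ([set val x | x in A], [set val x | x in B]) => /=.
    by split; [apply: filterS FA|apply: filterS FB] => x Fx; exists x.
  move=> [_ _] /= [[x Ax <-] [y By <-]].
  have := AB (x, y) (conj Ax By).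
  by rewrite /= -!ball_normE /= closed_span_normE raddfB.
have /cvg_ex[/= l vl] : cvg (val @ F) by exact: cauchy_cvg.
have lS : l \in closed_span.
  apply/closed_spanP => e e0.
  have e2 : 0 < e / 2 by rewrite divr_gt0.
  have /cvgrPdist_lt/(_ _ e2) Fl := vl.
  have [x /= xl] := filter_ex Fl.
  have /closed_spanP/(_ _ e2)[u Su xu] := valP x.
  exists u => //; rewrite -(subrK (val x) l) -addrA.
  by rewrite (le_lt_trans (ler_normD _ _))// [e]splitr ltrD.
apply/cvg_ex; exists (Sub l lS : closed_span_space).
apply/cvgrPdist_lt => e e0; have /cvgrPdist_lt/(_ _ e0) := vl.
by apply: filterS => x; rewrite closed_span_normE raddfB.
Qed.

HB.instance Definition _ :=
  Uniform_isComplete.Build closed_span_space closed_span_complete.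

Definition closed_span_inner (x y : closed_span_space) : R[i] :=
  inner (val x) (val y).

Fact closed_span_inner_bilinear :
  bilinear_for *%R (Num.conj \; *%R) closed_span_inner.
Proof.
have valP c (x y : closed_span_space) :
  val (c *: x + y) = c *: val x + val y by rewrite linearP.
split=> [v c x y|u c x y]; rewrite /closed_span_inner valP.
  exact: linearPl.
exact: linearPr.
Qed.

HB.instance Definition _ := @bilinear_isBilinear.Build R[i] closed_span_space
  closed_span_space R[i] *%R (Num.conj \; *%R) closed_span_inner
  closed_span_inner_bilinear.

Fact closed_span_inner_hermitian (x y : closed_span_space) :
  closed_span_inner x y =
  (-1) ^+ false * Num.conj (closed_span_inner y x).
Proof. by rewrite /closed_span_inner; exact: hermitian_subproof. Qed.

HB.instance Definition _ := isHermitianSesquilinear.Build R[i]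
  closed_span_space false Num.conj closed_span_inner
  closed_span_inner_hermitian.

Fact closed_span_inner_gt0 (x : closed_span_space) :
  x != 0 -> 0 < closed_span_inner x x.
Proof.
move=> x0; apply: neq0_dnorm_gt0; apply: contra_neq x0 => x0.
by apply: val_inj; rewrite x0 raddf0.
Qed.

HB.instance Definition _ := isDotProduct.Build R[i] closed_span_space
  closed_span_inner closed_span_inner_gt0.

Fact closed_span_inner_norm (x : closed_span_space) :
  closed_span_inner x x = `|x| ^+ 2.
Proof. by rewrite closed_span_normE -inner_norm. Qed.

HB.instance Definition _ := isHilbert.Build R closed_span_space
  closed_span_inner_norm.


End closed_span.

Definition uncond_prod (K : numFieldType) (z : nat -> K) (a : K) : Prop :=
  forall s : nat -> nat, bijective s ->
    (\prod_(i < N) z (s i)) @[N --> \oo] --> a.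

Section elementary_tensors.
Variable R : realType.
Implicit Types z : nat -> R[i].

(* The value of a quasi-convergent product: its unconditional limit if there is
   one, and otherwise 0, the default of [xget].  Only applied to products that
   are quasi-convergent. *)
Definition qprod z : R[i] := xget 0 [set a | uncond_prod z a].

(* sum_n |1 - z n| < oo *)
Definition summable_from1 z : Prop :=
  cvgn (series (fun n => `|1 - z n| : R[i]^o)).

Variable H : nat -> hilbertType R.
Implicit Types h f : forall n, H n.

Definition C_seq h : Prop := exists a : R[i], uncond_prod (fun n => `|h n|) a.

Definition C0_seq h : Prop := C_seq h /\ summable_from1 (fun n => `|h n|).

Definition C0_equiv h f : Prop := summable_from1 (fun n => inner (h n) (f n)).

Definition Cseqs := {h : forall n, H n | C_seq h}.

Definition elem_tensor (h : Cseqs) : Cseqs -> R[i]^o :=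
  fun f : Cseqs => qprod (fun n => inner (sval h n) (sval f n)).

(* A completion of the span of the elementary tensors, a space of functionals
   on [Cseqs], for the inner product determined by [ctp_emb_inner]: a Hilbert
   space with an isometric linear map from that span onto a dense subspace.
   Such a completion is unique up to a unitary isomorphism compatible with the
   embeddings.  The values of [ctp_emb] outside the span play no role. *)
Record complete_tensor_product := CompleteTensorProduct {
  ctp_space :> hilbertType R ;
  ctp_emb : (Cseqs -> R[i]^o) -> ctp_space ;
  ctp_emb_linear : forall (c : R[i]) (phi psi : Cseqs -> R[i]^o),
    lin_span (range elem_tensor) phi -> lin_span (range elem_tensor) psi ->
    ctp_emb (c *: phi + psi) = c *: ctp_emb phi + ctp_emb psi ;
  ctp_emb_inner : forall h f : Cseqs,
    inner (ctp_emb (elem_tensor h)) (ctp_emb (elem_tensor f)) =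
    qprod (fun n => inner (sval h n) (sval f n)) ;
  ctp_emb_dense :
    closure [set ctp_emb phi | phi in lin_span (range elem_tensor)] = setT
}.

Variable K : complete_tensor_product.

Definition tensor (h : Cseqs) : K := ctp_emb K (elem_tensor h).

Definition incomplete_tensor_product (y : forall n, H n) : hilbertType R :=
  closed_span_space [set u | exists h : Cseqs,
    [/\ C0_seq (sval h), C0_equiv (sval h) y & u = tensor h]].

(* [is_tensor_op A B]: the tensor product of the [A n] is well-defined on the
   incomplete tensor product and equals [B].  The sequence [h] ranges over all
   C-sequences whose elementary tensor lies in the incomplete tensor product,
   not only over the C_0-sequences equivalent to [y]; since elementary tensors
   span a dense subspace, there is at most one such [B]. *)
Definition is_tensor_op (y : forall n, H n) (A : forall n, {linear H n -> H n})
    (B : {linear incomplete_tensor_product y ->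
                 incomplete_tensor_product y}) : Prop :=
  bounded_near B (nbhs 0) /\
  forall (h : Cseqs) (u : incomplete_tensor_product y), val u = tensor h ->
    exists Ah : Cseqs, (forall n, sval Ah n = A n (sval h n)) /\
      val (B u) = tensor Ah.

End elementary_tensors.

Section operators.
Variables (R : realType) (V : hilbertType R).

(* Meaningful for bounded [A] only, as [sup] of an unbounded set is 0. *)
Definition opnorm (A : V -> V) : R :=
  sup [set complex.Re `|A x| | x in [set x | `|x| <= 1]].

Record C0_semigroup (T : R -> {linear V -> V}) : Prop := {
  C0_bounded : forall t, 0 <= t -> bounded_near (T t) (nbhs 0) ;
  C0_0 : forall x, T 0 x = x ;
  C0_D : forall s t, 0 <= s -> 0 <= t -> forall x, T (s + t) x = T s (T t x) ;
  C0_cont : forall x, {within `[0, +oo[, continuous (fun t => T t x)}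
}.

End operators.

(* Main.v *)
(** A nonzero elementary tensor lies in the incomplete tensor product of [y] only if
    its factors form a C_0-sequence equivalent to [y], and the tensors whose factors
    agree with those of [y] from some index on are total there.

    (b) => (c): if the tensor product [B] of operators [A n] is nonzero, then it does
    not vanish on one of these total tensors, say of [h].  So [A n (h n)], hence also
    [A n (y n)], is equivalent to [y], and modifying finitely many factors of [h]
    bounds the product of the norms of the [A n] by that of [B].

    (c) => (a): acting on one factor by [A n] has norm at most that of [A n], by
    Schur's product theorem; in the limit this yields [B] on the total tensors.  As
    the norms of the [A n] are summably close to 1, [A] preserves equivalence to
    [y], so that [B] acts factorwise everywhere.  An orbit of the resulting
    semigroup is a pointwise limit of continuous maps, hence right-continuous at
    every [s > 0] by Baire's theorem and the semigroup law.  To reach [0], compare the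
    tensor of [h] with the one having factors [h n] for [n < N] and [T n s (h n)]
    for [n >= N].

    (a) => (b) is the uniform boundedness principle. *)

Require Import Defs.
From HB Require Import structures.
From mathcomp Require Import all_boot all_order all_algebra.
From mathcomp Require Import all_classical all_reals all_analysis.
From mathcomp Require Import complex ring lra zify.

Set Implicit Arguments.
Unset Strict Implicit.
Unset Printing Implicit Defensive.

Import Order.TTheory GRing.Theory Num.Theory.
Import numFieldNormedType.Exports.

Local Open Scope classical_set_scope.
Local Open Scope ring_scope.

(** Everything rests on one fact about scalars: an unconditionally convergent product with nonzero
    value has [|1 - z n|] summable. As [qprod] is 0 where there is no limit, a nonzero inner product
    of elementary tensors forces summability, and questions about tensors become questions about
    summable sequences.

    Equivalent sequences differ only by a square-summable amount, so terms of first order in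
    [f n - y n] are the obstacle to [A] preserving equivalence. They are controlled because the norm
    of [A n] is close to 1 and nearly attained at [y n].

    Elementary tensors do not determine their factors. Hence the operator is built from a linear
    relation, made single-valued by its norm bound, and C-sequences with vanishing tensor are
    treated apart, since their factors need not be equivalent to [y].

    The semigroups [T n] share no modulus of continuity at 0. Products with finitely many moving
    factors are continuous, but they converge only pointwise in time; this is why Baire's theorem is
    called for. *)

Local Notation Re := complex.Re.
Local Notation Im := complex.Im.
Local Notation "x %:C" := (real_complex _ x) (format "x %:C") : ring_scope.

(* Unconditional convergence is convergence along [fins], the filter of finite
   sets of indices, listed without repetition. *)
Definition fins : set_system (seq nat) := [set P | exists N, forall F : seq nat,
  uniq F -> {subset iota 0 N <= F} -> P F].

Global Instance fins_filter : ProperFilter fins.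
Proof.
apply: Build_ProperFilter; first by case=> N /(_ _ (iota_uniq 0 N)); apply.
split=> [|P Q [N PN] [M QM]|P Q PQ [N PN]]; first by exists 0%N.
  exists (N + M)%N => F uF sF; split; [apply: PN|apply: QM] => // i.
    by rewrite mem_iota => ?; apply: sF; rewrite mem_iota; lia.
  by rewrite mem_iota => ?; apply: sF; rewrite mem_iota; lia.
by exists N => F uF sF; apply/PQ/PN.
Qed.

Lemma fins_uniq : \forall F \near fins, uniq F.
Proof. by exists 0%N. Qed.

(** * Unconditional products as limits along finite sets of indices *)

Section unconditional_products.
Variable K : numFieldType.
Implicit Types (z : nat -> K) (a : K) (F : seq nat).

Definition hasprod z a := \prod_(i <- F) z i @[F --> fins] --> a.

Lemma hasprod_uncond_prod z a : hasprod z a -> uncond_prod z a.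
Proof.
move=> za s [s' sK s'K]; apply/cvgrPdist_lt => e e0.
have [N FN] : \forall F \near fins, `|\prod_(i <- F) z i - a| < e.
  by apply: cvgr_distC_lt za _ e0.
(* From this index on, the rearranged initial segments contain all of [0, ..., N - 1]. *)
exists (\max_(i < N) (s' i).+1)%N => // n /= nM.
have -> : \prod_(i < n) z (s i) = \prod_(i <- [seq s i | i <- iota 0 n]) z i.
  by rewrite big_map -(big_mkord xpredT (fun i => z (s i))) /index_iota subn0.
rewrite distrC; apply: (FN [seq s i | i <- iota 0 n]); first by rewrite (map_inj_uniq (can_inj sK)) iota_uniq.
move=> i; rewrite mem_iota /= add0n => iN; rewrite -(s'K i) map_f//.
rewrite mem_iota add0n /=; apply: leq_trans nM.
exact: (leq_bigmax (F := fun i : 'I_N => (s' i).+1) (Ordinal iN)).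
Qed.

(* If the finite partial products stay away from [a], list bad finite sets one
   after the other, filling the gaps, to get a bijection violating unconditional
   convergence.  [L k] is the k-th prefix of the rearrangement. *)
Lemma uncond_prod_hasprod z a : uncond_prod z a -> hasprod z a.
Proof.
move=> za; apply/cvgrPdist_lt => e e0; apply: contrapT => /forallNP bad.
have {}bad N : exists F, [/\ uniq F, {subset iota 0 N <= F} &
    ~ `|a - \prod_(i <- F) z i| < e].
  by have /existsNP[F /not_implyP[uF /not_implyP[sF nF]]] := bad N; exists F.
have [G Gbad] := choice bad.
pose m (F : seq nat) := (\max_(i <- F) i.+1)%N.
(* [l ++ mid l] lists the bad set [G (size l).+1]; the successor makes it strictly longer than [l].
   The last piece of [next l] fills the gaps below the maximum, so that each [L k] permutes an
   initial segment and the limit is onto. *)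
pose mid (l : seq nat) := [seq i <- G (size l).+1 | i \notin l].
pose next (l : seq nat) :=
  let g := G (size l).+1 in l ++ mid l ++ [seq i <- iota 0 (m g) | i \notin g].
pose L k := iter k next [::].
have ltm l i : i \in l -> (i < m l)%N.
  by move=> il; apply: (leq_bigmax_seq (F := fun j => j.+1)).
have Linv k : perm_eq (L k) (iota 0 (size (L k))).
  elim: k => [|k IH] //.
  have [uG sG _] := Gbad (size (L k)).+1.
  have LG : {subset L k <= G (size (L k)).+1}.
    by move=> i; rewrite (perm_mem IH) => il; apply: sG; move: il; rewrite !mem_iota; lia.
  have mem_next : next (L k) =i iota 0 (m (G (size (L k)).+1)).
    move=> i; rewrite !mem_cat !mem_filter.
    case: (boolP (i \in L k)) => [/LG iG|iL] /=; last first.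
      case: (boolP (i \in G _)) => //= iG; rewrite mem_iota /= add0n.
      by rewrite ltm.
    by rewrite mem_iota /= add0n ltm.
  have un : uniq (next (L k)).
    rewrite !cat_uniq (perm_uniq IH) iota_uniq /=; apply/and3P; split.
    - apply/hasPn => i; rewrite mem_cat !mem_filter => /orP[/andP[]//|/andP[iG _]].
      by apply: contra iG; apply: LG.
    - exact: filter_uniq.
    - rewrite filter_uniq ?iota_uniq// andbT; apply/hasPn => i /=.
      by rewrite !mem_filter => /andP[iG _]; rewrite (negbTE iG) andbF.
  have pe := uniq_perm un (iota_uniq _ _) mem_next.
  by rewrite [L k.+1]/= (perm_size pe) size_iota.
have perm_mid k : perm_eq (L k ++ mid (L k)) (G (size (L k)).+1).
  have [uG sG _] := Gbad (size (L k)).+1.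
  have LG : {subset L k <= G (size (L k)).+1}.
    by move=> i; rewrite (perm_mem (Linv k)) => il; apply: sG; move: il; rewrite !mem_iota; lia.
  apply: uniq_perm => // [|i].
    rewrite cat_uniq (perm_uniq (Linv k)) iota_uniq filter_uniq//= andbT.
    by apply/hasPn => i; rewrite mem_filter => /andP[].
  by rewrite mem_cat mem_filter; case: (boolP (i \in L k)) => //= /LG ->.
have size_mid k : (size (L k) < size (L k ++ mid (L k)))%N.
  have [uG sG _] := Gbad (size (L k)).+1.
  rewrite (perm_size (perm_mid k)).
  by have := uniq_leq_size (iota_uniq _ _) sG; rewrite size_iota.
have LS k : L k.+1 = (L k ++ mid (L k)) ++
    [seq i <- iota 0 (m (G (size (L k)).+1)) | i \notin G (size (L k)).+1].
  by rewrite -catA.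
have size_L k : (k <= size (L k))%N.
  elim: k => // k IH; rewrite LS size_cat.
  by apply: leq_trans (leq_addr _ _); apply: leq_ltn_trans IH (size_mid k).
have Lpre k j n : (k <= j)%N -> (n < size (L k))%N -> nth 0%N (L j) n = nth 0%N (L k) n.
  move=> /subnK <-; elim: (j - k)%N => // d IH nk.
  have size_le d' : (size (L k) <= size (L (d' + k)))%N.
    elim: d' => // d' IH'; apply: leq_trans IH' _.
    by rewrite addSn LS !size_cat -addnA leq_addr.
  by rewrite addSn LS -catA nth_cat (leq_trans nk (size_le d)) IH.
pose s n := nth 0%N (L n.+1) n.
have sE k n : (n < size (L k))%N -> s n = nth 0%N (L k) n.
  move=> nk; case: (leqP k n.+1) => kn; first by rewrite /s (Lpre k).
  by rewrite /s -(Lpre n.+1 k)// ltnW.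
have uL k : uniq (L k) by rewrite (perm_uniq (Linv k)) iota_uniq.
have s_inj : injective s.
  move=> i j; pose k := (maxn i j).+1.
  have ik : (i < size (L k))%N by apply: leq_trans (size_L k); rewrite ltnS leq_maxl.
  have jk : (j < size (L k))%N by apply: leq_trans (size_L k); rewrite ltnS leq_maxr.
  by rewrite !(sE k)// => /eqP; rewrite nth_uniq// => /eqP.
pose s' i := index i (L i.+1).
have s'K : cancel s' s.
  move=> i; have iL : i \in L i.+1.
    by rewrite (perm_mem (Linv _)) mem_iota /= add0n.
  by rewrite (sE i.+1) ?nth_index// index_mem.
have sbij : bijective s by exists s' => // n; apply: s_inj; rewrite s'K.
have /cvgrPdist_lt/(_ e e0)[N _ /= Ncvg] := za s sbij.
pose n := size (L N ++ mid (L N)).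
have := Ncvg n (leq_trans (size_L N) (ltnW (size_mid N))).
move=> close; have [_ _] := Gbad (size (L N)).+1; apply; move: close.
suff <- : \prod_(i < n) z (s i) = \prod_(i <- G (size (L N)).+1) z i by [].
rewrite -(perm_big _ (perm_mid N)) /= (big_nth 0%N) big_mkord; apply: eq_bigr => i _.
congr z; rewrite (sE N.+1) LS ?nth_cat ?(ltn_ord i)// size_cat.
exact: leq_trans (ltn_ord i) (leq_addr _ _).
Qed.

Lemma uncond_prodP z a : uncond_prod z a <-> hasprod z a.
Proof. by split; [exact: uncond_prod_hasprod|exact: hasprod_uncond_prod]. Qed.

Lemma hasprod_unique z a b : hasprod z a -> hasprod z b -> a = b.
Proof. by move=> za zb; apply: cvg_unique za zb => //; exact: norm_hausdorff. Qed.

Lemma hasprodM z w a b : hasprod z a -> hasprod w b ->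
  hasprod (fun n => z n * w n) (a * b).
Proof.
move=> za wb; rewrite /hasprod; under eq_cvg do rewrite big_split /=.
exact: cvgM.
Qed.

End unconditional_products.

Lemma big_uniq_sub (R : comNzSemiRingType) (z : nat -> R) (G F : seq nat) :
  uniq G -> uniq F -> {subset G <= F} ->
  \prod_(i <- F) z i = \prod_(i <- G) z i * \prod_(i <- [seq i <- F | i \notin G]) z i.
Proof.
move=> uG uF GF; rewrite (bigID (mem G)) /= big_filter; congr (_ * _).
rewrite -big_filter; apply: perm_big; apply: uniq_perm => //.
  exact: filter_uniq.
by move=> i; rewrite mem_filter; case: (boolP (i \in G)) => //= /GF ->.
Qed.

(** * Summability and absolutely convergent products *)

Section real_norm.
Variable R : realType.

(** Norms take values in [R[i]], whose order is partial; this real version is accessible to linear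
    arithmetic. *)
Definition nm (V : normedZmodType R[i]) (x : V) : R := Re `|x|.

Section nmz.
Variable V : normedZmodType R[i].
Implicit Types x y : V.

Lemma nmE x : `|x| = (nm x)%:C.
Proof. by rewrite /nm RRe_real// normr_real. Qed.

Lemma nm_ge0 x : 0 <= nm x.
Proof. by rewrite -lecR -nmE normr_ge0. Qed.

Lemma nm_lt x (e : R) : (`|x| < e%:C) = (nm x < e).
Proof. by rewrite nmE ltcR. Qed.

Lemma nm_le x (e : R) : (`|x| <= e%:C) = (nm x <= e).
Proof. by rewrite nmE lecR. Qed.

Lemma nm_eq0 x : (nm x == 0) = (x == 0).
Proof. by rewrite -(normr_eq0 x) nmE (inj_eq (@complexI R)). Qed.

Lemma nm0 : nm (0 : V) = 0.
Proof. by apply/eqP; rewrite nm_eq0. Qed.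

Lemma nm_gt0 x : (0 < nm x) = (x != 0).
Proof. by rewrite lt_def nm_ge0 nm_eq0 andbT. Qed.

Lemma nmN x : nm (- x) = nm x.
Proof. by rewrite /nm normrN. Qed.

Lemma nmC x y : nm (x - y) = nm (y - x).
Proof. by rewrite /nm distrC. Qed.

Lemma nmD x y : nm (x + y) <= nm x + nm y.
Proof. by rewrite -lecR -nmE rmorphD /= -!nmE ler_normD. Qed.

Lemma nmB x y : nm (x - y) <= nm x + nm y.
Proof. by rewrite -(nmN y) nmD. Qed.

Lemma nm_tri z x y : nm (x - y) <= nm (x - z) + nm (z - y).
Proof. by rewrite (le_trans _ (nmD _ _))// addrA subrK. Qed.

Lemma nm_sub_le x y : nm x - nm y <= nm (x - y).
Proof. by rewrite lerBlDr (le_trans _ (nmD _ _))// subrK. Qed.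

End nmz.

Lemma complex_gt0 (e : R[i]) : 0 < e -> 0 < Re e /\ e = (Re e)%:C.
Proof.
move=> e0; have eE : e = (Re e)%:C by rewrite RRe_real// gtr0_real.
by move: e0; rewrite {1}eE ltcR.
Qed.

Lemma nmZ (V : normedModType R[i]) (c : R[i]) (x : V) : nm (c *: x) = nm c * nm x.
Proof. by apply: complexI; rewrite -nmE normrZ rmorphM /= -!nmE. Qed.

Lemma cvg_nmP (V : normedModType R[i]) (T : Type) (F : set_system T)
    {FF : Filter F} (f : T -> V) (l : V) :
  f @ F --> l <-> forall e : R, 0 < e -> \forall t \near F, nm (l - f t) < e.
Proof.
split=> [/cvgrPdist_lt fl e e0|fl].
  have eC : 0 < e%:C by rewrite ltcR.
  by have := fl _ eC; apply: filterS => t; rewrite nm_lt.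
apply/cvgrPdist_lt => e /complex_gt0[e0 ->].
by have := fl _ e0; apply: filterS => t; rewrite nm_lt.
Qed.

Lemma cvg_nm (V : normedModType R[i]) (T : Type) (F : set_system T)
    {FF : Filter F} (f : T -> V) (l : V) :
  f @ F --> l -> nm (f t) @[t --> F] --> nm l.
Proof.
move=> /cvg_nmP fl; apply/cvgrPdist_lt => e e0.
have := fl _ e0; apply: filterS => t; apply: le_lt_trans.
by rewrite ler_norml lerNl opprB [X in _ && X]nm_sub_le andbT nmC nm_sub_le.
Qed.

Implicit Types z w : R[i].

Lemma nmM z w : nm (z * w) = nm z * nm w.
Proof. by apply: complexI; rewrite -nmE normrM rmorphM /= -!nmE. Qed.

Lemma nm1 : nm (1 : R[i]) = 1.
Proof. by rewrite /nm normr1. Qed.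

Lemma nm_prod (I : Type) (r : seq I) (P : pred I) (F : I -> R[i]) :
  nm (\prod_(i <- r | P i) F i) = \prod_(i <- r | P i) nm (F i).
Proof. by rewrite (big_morph (@nm _) nmM nm1). Qed.

Lemma nm_real (x : R) : nm (x%:C : R[i]) = `|x|.
Proof. by rewrite /nm normc_def /= expr0n /= addr0 sqrtr_sqr. Qed.

Lemma nm_nm (V : normedZmodType R[i]) (x : V) : nm (`|x| : R[i]) = nm x.
Proof. by rewrite /nm normr_id. Qed.

Lemma Re_le_nm z : `|Re z| <= nm z.
Proof. by rewrite -lecR -nmE normc_ge_Re. Qed.

Lemma Im_le_nm z : `|Im z| <= nm z.
Proof.
have -> : Im z = - Re (z * 'i%C) by rewrite ReiNIm opprK.
rewrite normrN (le_trans (Re_le_nm _))// nmM.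
by rewrite {2}/nm normc_def /= expr0n expr1n add0r sqrtr1 mulr1.
Qed.

Lemma nm_le_ReIm z : nm z <= `|Re z| + `|Im z|.
Proof.
rewrite /nm normc_def /= -[leRHS]ger0_norm ?addr_ge0// -sqrtr_sqr ler_wsqrtr//.
by rewrite sqrrD !real_normK ?num_real// addrAC lerDl mulrn_wge0.
Qed.

End real_norm.

Section summability.
Variable R : realType.
Implicit Types (a b : nat -> R) (z w : nat -> R[i]) (F : seq nat).

(** For nonnegative [a] this is convergence of the series, in a form that passes to smaller
    sequences without handling limits. *)
Definition summ a := exists B, forall N, \sum_(i < N) a i <= B.

Lemma summ_le a b : (forall n, a n <= b n) -> summ b -> summ a.
Proof.
by move=> ab [B bB]; exists B => N; apply: le_trans (bB N); apply: ler_sum.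
Qed.

Lemma summD a b : summ a -> summ b -> summ (fun n => a n + b n).
Proof.
by move=> [A aA] [B bB]; exists (A + B) => N; rewrite big_split lerD.
Qed.

Lemma summZ (c : R) a : 0 <= c -> summ a -> summ (fun n => c * a n).
Proof.
by move=> c0 [A aA]; exists (c * A) => N; rewrite -mulr_sumr ler_wpM2l.
Qed.

Lemma summ_ev a b N : (forall n, (N <= n)%N -> a n <= b n) ->
  (forall n, 0 <= b n) -> summ b -> summ a.
Proof.
move=> ab b0 [B bB]; exists (\sum_(i < N) `|a i| + B) => M.
apply: (@le_trans _ _ (\sum_(i < M + N) (`|a i| *+ (i < N)%N + b i))).
  rewrite big_split_ord /= -[leLHS]addr0 lerD//.
    apply: ler_sum => i _; case: ltnP => iN; last by rewrite add0r ab.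
    by rewrite (le_trans (ler_norm _))// lerDl.
  by apply: sumr_ge0 => i _; rewrite addr_ge0// mulrn_wge0.
rewrite big_split lerD// addnC big_split_ord /=.
rewrite [X in _ + X]big1 ?addr0 => [|i _]; last by rewrite ltnNge leq_addr.
by apply: ler_sum => i _; rewrite ltn_ord.
Qed.

Lemma summ_uniq a B : (forall n, 0 <= a n) -> (forall N, \sum_(i < N) a i <= B) ->
  forall F, uniq F -> \sum_(i <- F) a i <= B.
Proof.
move=> a0 aB F uF; apply: le_trans (aB (\max_(i <- F) i.+1)%N).
rewrite -(big_mkord xpredT a) [leRHS](bigID (mem F)) /= ler_wpDr ?sumr_ge0//.
rewrite -[leRHS]big_filter le_eqVlt; apply/orP; left; apply/eqP.
apply: perm_big; apply: uniq_perm => //; first by rewrite filter_uniq ?iota_uniq.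
move=> i; rewrite mem_filter mem_index_iota; case: (boolP (i \in F)) => //= iF.
by apply/esym/(leq_bigmax_seq (F := fun j => j.+1)).
Qed.

Lemma summ_tail a : (forall n, 0 <= a n) -> summ a -> forall e, 0 < e ->
  exists N, forall F, uniq F -> (forall i, i \in F -> (N <= i)%N) ->
    \sum_(i <- F) a i < e.
Proof.
move=> a0 [B aB] e e0; pose S := [set \sum_(i < N) a i | N in setT].
have S0 : S !=set0 by exists (\sum_(i < 0) a i); exists 0%N.
have Sub : has_ubound S by exists B => _ [N _ <-].
have [_ [N _ <-] SN] := sup_adherent e0 (conj S0 Sub).
exists N => F uF FN.
have SB M : \sum_(i < M) a i <= sup S by apply: sup_upper_bound => //; exists M.
have uNF : uniq (iota 0 N ++ F).
  rewrite cat_uniq iota_uniq uF andbT /=; apply/hasPn => i /FN.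
  by rewrite mem_iota /= add0n -leqNgt.
have := summ_uniq a0 SB uNF; rewrite big_cat /=.
have -> : \sum_(i <- iota 0 N) a i = \sum_(i < N) a i.
  by rewrite -(big_mkord xpredT a) /index_iota subn0.
by move: SN; set x := \sum_(i < N) _; set y := \sum_(i <- F) _; lra.
Qed.

Lemma summ_lt a e : (forall n, 0 <= a n) -> summ a -> 0 < e ->
  exists N, forall n, (N <= n)%N -> a n < e.
Proof.
move=> a0 sa /(summ_tail a0 sa)[N aN]; exists N => n Nn.
by have := aN [:: n] isT; rewrite big_seq1; apply => i; rewrite inE => /eqP ->.
Qed.

Lemma summ_bounded a : (forall n, 0 <= a n) -> summ a ->
  exists2 B, 0 <= B & forall n, a n <= B.
Proof.
move=> a0 [B aB]; exists B; first by have := aB 0%N; rewrite big_ord0.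
move=> n; apply: le_trans (aB n.+1).
by rewrite big_ord_recr /= ler_wpDl// sumr_ge0.
Qed.

Lemma summable_from1P z : summable_from1 z <-> summ (fun n => nm (1 - z n)).
Proof.
have SE N : series (fun n => `|1 - z n|) N = (\sum_(i < N) nm (1 - z i))%:C.
  rewrite /series /= big_mkord rmorph_sum /=.
  by apply: eq_bigr => i _; rewrite nmE.
split=> [/cvg_ex[/= l /cvg_nmP/(_ 1 ltr01)[N _ /= Nl]]|[B zB]].
  exists (nm (l : R[i]) + 1) => M; apply: (@le_trans _ _ (\sum_(i < maxn N M) nm (1 - z i))).
    rewrite -!(big_mkord xpredT (fun i => nm (1 - z i))).
    rewrite [leRHS](big_cat_nat _ (n := M)) ?leq_maxr//= lerDl.
    by apply: sumr_ge0 => i _; exact: nm_ge0.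
  have := Nl (maxn N M) (leq_maxl _ _); rewrite SE nmC => h.
  have := nm_sub_le ((\sum_(i < maxn N M) nm (1 - z i))%:C : R[i]) l.
  rewrite nm_real ger0_norm; last by apply: sumr_ge0 => i _; exact: nm_ge0.
  by move=> /le_lt_trans/(_ h); rewrite ltrBlDl => /ltW; rewrite addrC.
have : cvgn (fun N => \sum_(i < N) nm (1 - z i)).
  apply: nondecreasing_is_cvgn.
    apply/nondecreasing_seqP => n; rewrite big_ord_recr /= lerDl; exact: nm_ge0.
  by exists B => _ [N _ <-].
move=> /cvg_ex[/= l /cvgrPdist_lt Sl]; apply/cvg_ex; exists l%:C.
apply/cvg_nmP => e e0; have := Sl e e0; apply: filterS => N.
by rewrite SE -rmorphB nm_real.
Qed.

Lemma complex_cauchy (T : Type) (F : set_system T) {FF : ProperFilter F}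
    (f : T -> R[i]) :
  (forall e : R, 0 < e -> exists x, \forall t \near F, nm (x - f t) < e) ->
  exists l : R[i], f @ F --> (l : R[i]^o).
Proof.
move=> fc.
have part (p : R[i] -> R) : {morph p : x y / x - y} -> (forall x, `|p x| <= nm x) ->
    exists l : R, (p \o f) @ F --> l.
  move=> pB pnm; apply/cvg_ex; apply: cauchy_cvg; apply: cauchy_exP => e e0.
  have [x xf] := fc e e0; exists (p x); rewrite /= nbhs_simpl /=.
  apply: filterS xf => t; rewrite -ball_normE /= -pB; exact: le_lt_trans.
have ReB : {morph @Re R : x y / x - y} by case=> ? ? [].
have ImB : {morph @Im R : x y / x - y} by case=> ? ? [].
have [a fa] := part (@Re R) ReB (@Re_le_nm R).
have [b fb] := part (@Im R) ImB (@Im_le_nm R).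
exists (Complex a b); apply/(@cvg_nmP R R[i]^o) => e e0.
have e2 : 0 < e / 2 by rewrite divr_gt0.
move/cvgrPdist_lt/(_ _ e2) : fa; move/cvgrPdist_lt/(_ _ e2) : fb.
apply: filterS2 => t /= bt at_; rewrite (le_lt_trans (nm_le_ReIm _))//.
by rewrite [e]splitr ReB ImB /= ltrD.
Qed.

Lemma hasprod_nmP z (a : R[i]) : hasprod z a <-> forall e : R, 0 < e ->
  \forall F \near fins, nm (a - \prod_(i <- F) z i) < e.
Proof. exact: (@cvg_nmP R R[i]^o). Qed.

Lemma hasprod_nm z (a : R[i]) : hasprod z a -> hasprod (fun n => nm (z n)) (nm a).
Proof.
move=> za; rewrite /hasprod; under eq_cvg do rewrite -nm_prod.
exact: (@cvg_nm R R[i]^o).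
Qed.

Lemma hasprod_real (r : nat -> R) (p : R) :
  hasprod (fun n => (r n)%:C) p%:C <-> hasprod r p.
Proof.
rewrite hasprod_nmP; split=> [rp|/cvgrPdist_lt rp e e0].
  apply/cvgrPdist_lt => e e0; apply: filterS (rp e e0) => F.
  by rewrite -rmorph_prod -rmorphB nm_real.
by apply: filterS (rp e e0) => F; rewrite -rmorph_prod -rmorphB nm_real.
Qed.

End summability.

Section absolute_products.
Variable R : realType.
Implicit Types (z w : nat -> R[i]) (F G : seq nat).

(** In the induction the cross term [(1 - z n) * (1 - p)] has norm at most [nm (1 - z n) * (2 * s)],
    hence at most [nm (1 - z n)] since [s <= 1 / 2]; this explains the factor 2. *)
Lemma nm_prod_sub1 z F : \sum_(i <- F) nm (1 - z i) <= 1 / 2 ->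
  nm (1 - \prod_(i <- F) z i) <= 2 * \sum_(i <- F) nm (1 - z i).
Proof.
elim: F => [_|n F IH]; first by rewrite !big_nil subrr nm0 mulr0.
rewrite !big_cons; set s := \sum_(i <- F) _; set p := \prod_(i <- F) _ => s2.
have s0 : 0 <= s by apply: sumr_ge0 => i _; exact: nm_ge0.
have d0 := nm_ge0 (1 - z n).
have {}IH : nm (1 - p) <= 2 * s by apply: IH; rewrite -/s; lra.
have -> : 1 - z n * p = (1 - z n) + (1 - p) - (1 - z n) * (1 - p) by ring.
have := nmB ((1 - z n) + (1 - p)) ((1 - z n) * (1 - p)).
have := nmD (1 - z n) (1 - p); rewrite nmM.
have := nm_ge0 (1 - p).
have : nm (1 - z n) * nm (1 - p) <= nm (1 - z n) * (2 * s) by rewrite ler_wpM2l.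
nra.
Qed.

Lemma summ_prod_tail z : summ (fun n => nm (1 - z n)) -> forall e, 0 < e ->
  exists N, forall F, uniq F -> (forall i, i \in F -> (N <= i)%N) ->
    nm (1 - \prod_(i <- F) z i) < e.
Proof.
move=> zs e e0; pose d := Num.min (1 / 2) (e / 2).
have d0 : 0 < d by rewrite lt_min !divr_gt0.
have [d1 d2] : d <= 1 / 2 /\ d <= e / 2 by rewrite !ge_min !lexx orbT.
have [|N FN] := summ_tail _ zs d0; first by move=> n; exact: nm_ge0.
exists N => F uF NF; have sd := FN F uF NF.
have := nm_prod_sub1 (le_trans (ltW sd) d1); move: sd.
by set s := \sum_(i <- F) _; set x := nm _; lra.
Qed.

Lemma sub_notin N G F : {subset iota 0 N <= G} ->
  forall i, i \in [seq j <- F | j \notin G] -> (N <= i)%N.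
Proof.
move=> sG i; rewrite mem_filter leqNgt => /andP[iG _]; apply: contra iG => iN.
by apply: sG; rewrite mem_iota.
Qed.

Lemma summ_prod_bounded z : summ (fun n => nm (1 - z n)) ->
  exists2 C, 0 < C & \forall F \near fins, nm (\prod_(i <- F) z i) <= C.
Proof.
move=> zs; have [N zN] := summ_prod_tail zs ltr01.
pose p := nm (\prod_(i <- iota 0 N) z i).
have p0 : 0 <= p by exact: nm_ge0.
exists (2 * (p + 1)); first by rewrite mulr_gt0// ltr_wpDl.
exists N => F uF sF /=.
rewrite (big_uniq_sub z (iota_uniq 0 N) uF sF) nmM -/p.
set q := \prod_(i <- _) _.
have /ltW q1 : nm (1 - q) < 1.
  by apply: zN; [exact: filter_uniq|exact: sub_notin].
have q2 : nm q <= 2.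
  have := nm_sub_le q 1; rewrite nmC nm1; lra.
have := nm_ge0 q; nra.
Qed.

Lemma summ_hasprod z : summ (fun n => nm (1 - z n)) ->
  exists a : R[i], hasprod z a /\ ((forall n, z n != 0) -> a != 0).
Proof.
move=> zs; have [C C0 zC] := summ_prod_bounded zs.
have [a za] : exists a : R[i], \prod_(i <- F) z i @[F --> fins] --> (a : R[i]^o).
  apply: complex_cauchy => e e0.
  have [N zN] := summ_prod_tail zs (divr_gt0 e0 C0).
  have [N' zN'] := zC.
  pose G := iota 0 (N + N').
  exists (\prod_(i <- G) z i); exists (N + N')%N => F uF sF /=.
  rewrite (big_uniq_sub z (iota_uniq 0 (N + N')) uF sF) -/G.
  set q := \prod_(i <- [seq _ <- F | _]) _.
  set p := \prod_(i <- G) _.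
  have q1 : nm (1 - q) < e / C.
    apply: zN; first exact: filter_uniq.
    by move=> i /sub_notin => /(_ (N + N')%N (fun _ => id)); lia.
  have pC : nm p <= C.
    apply: zN'; first exact: iota_uniq.
    by move=> i; rewrite !mem_iota; lia.
  have -> : p - p * q = p * (1 - q) by ring.
  rewrite nmM (le_lt_trans (ler_wpM2r (nm_ge0 _) pC))//.
  by rewrite mulrC -ltr_pdivlMr.
(* Past [N] every finite tail product has norm above [1 / 2], so the partial products stay above
   [nm p / 2] in norm, while they come closer than that to [a]. *)
exists a; split=> // z0; have h2 : 0 < 1 / 2 :> R by lra.
have [N zN] := summ_prod_tail zs h2.
pose p := \prod_(i <- iota 0 N) z i.
have p0 : 0 < nm p by rewrite nm_gt0 prodf_seq_neq0; apply/allP => i _; exact: z0.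
rewrite -nm_gt0; have [M zM] := (hasprod_nmP _ _).1 za _ (divr_gt0 p0 (ltr0Sn R 1)).
pose F := iota 0 (N + M).
have sF : {subset iota 0 N <= F} by move=> i; rewrite !mem_iota; lia.
have : nm (a - \prod_(i <- F) z i) < nm p / 2.
  by apply: zM; [exact: iota_uniq|move=> i; rewrite !mem_iota; lia].
rewrite (big_uniq_sub z (iota_uniq 0 N) (iota_uniq _ _) sF) -/p.
set q := \prod_(i <- [seq _ <- F | _]) _.
have q1 : nm (1 - q) < 1 / 2.
  by apply: zN; [exact/filter_uniq/iota_uniq|exact: sub_notin].
have := nm_sub_le (p * q) (p * q - a); rewrite subKr nmC nmM.
have := nm_sub_le 1 (1 - q); rewrite subKr nm1.
nra.
Qed.

(** A dominated convergence: [b F] is a product of [z] over [F], which is bounded, times a tail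
    product of [w] outside [F], which is close to 1 as soon as [F] contains a long initial
    segment. *)
Lemma hasprod_mix z w (a : R[i]) (b : seq nat -> R[i]) :
  summ (fun n => nm (1 - z n)) -> summ (fun n => nm (1 - w n)) ->
  hasprod z a ->
  (forall F, uniq F -> hasprod (fun n => if n \in F then z n else w n) (b F)) ->
  b F @[F --> fins] --> (a : R[i]^o).
Proof.
move=> zs ws za zb; apply/(@cvg_nmP R R[i]^o) => e e0.
have [C C0 [N' zC]] := summ_prod_bounded zs.
have e3 : 0 < e / 3 by rewrite divr_gt0.
have [N wN] := summ_prod_tail ws (divr_gt0 e3 C0).
have [M zM] := (hasprod_nmP _ _).1 za _ e3.
exists (N + N' + M)%N => F uF sF /=.
have aF : nm (a - \prod_(i <- F) z i) < e / 3.
  by apply: zM => // i; rewrite mem_iota => ?; apply: sF; rewrite mem_iota; lia.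
have [L bL] := (hasprod_nmP _ _).1 (zb F uF) _ e3.
pose G := F ++ [seq i <- iota 0 L | i \notin F].
have uG : uniq G.
  rewrite cat_uniq uF filter_uniq ?iota_uniq// andbT /=; apply/hasPn => i.
  by rewrite mem_filter => /andP[].
have := bL G uG; rewrite /=.
have -> : \prod_(i <- G) (if i \in F then z i else w i) =
    \prod_(i <- F) z i * \prod_(i <- [seq i <- iota 0 L | i \notin F]) w i.
  rewrite big_cat /=; congr (_ * _); apply: eq_big_seq => i.
    by move=> ->.
  by rewrite mem_filter => /andP[/negbTE ->].
set p := \prod_(i <- F) z i; set q := \prod_(i <- _) w i => bG.
have q1 : nm (1 - q) < e / 3 / C.
  apply: wN; first exact/filter_uniq/iota_uniq.
  by move=> i /(sub_notin sF); lia.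
have pC : nm p <= C.
  by apply: zC => // i; rewrite mem_iota => ?; apply: sF; rewrite mem_iota; lia.
have pq : nm (p - p * q) < e / 3.
  have -> : p - p * q = p * (1 - q) by ring.
  rewrite nmM (le_lt_trans (ler_wpM2r (nm_ge0 _) pC))//.
  by rewrite mulrC -ltr_pdivlMr.
have bG' : nm (p * q - b F) < e / 3.
  rewrite nmC; apply: bG => i; rewrite /G mem_cat mem_filter => ->.
  by case: (i \in F).
have := nm_tri p a (b F); have := nm_tri (p * q) p (b F); move: aF; rewrite -/p; lra.
Qed.

(* Each complex number lies in one of four sectors on which the norm is at most
   twice one of the functionals [Re], [-Re], [Im], [-Im].  Over a finite set [F]
   of indices in such a sector, [\prod (1 + w i) - 1 - \sum w i] is bounded by
   [1/8 * \sum nm (w i)], which bounds [\sum nm (w i)]. *)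
Lemma sector_bound (l : R[i] -> R) w F :
  {morph l : x y / x + y} -> (forall x, l x <= nm x) ->
  (forall G, uniq G -> {subset G <= F} -> nm (\prod_(i <- G) (1 + w i) - 1) <= 1 / 8) ->
  uniq F -> (forall i, i \in F -> nm (w i) <= 2 * l (w i)) ->
  \sum_(i <- F) nm (w i) <= 1.
Proof.
move=> lD lnm.
have l0 : l 0 = 0 by apply: (addrI (l 0)); rewrite -lD !addr0.
move=> wF uF lF.
have lsum : \sum_(i <- F) l (w i) = l (\sum_(i <- F) w i).
  by rewrite (big_morph l lD l0).
have S2 : \sum_(i <- F) nm (w i) <= 2 * l (\sum_(i <- F) w i).
  by rewrite -lsum mulr_sumr !big_seq; apply: ler_sum.
have P : nm (\prod_(i <- F) (1 + w i) - 1 - \sum_(i <- F) w i) <=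
    1 / 8 * \sum_(i <- F) nm (w i).
  elim: (F) wF uF => [_ _|n G IH wG /= /andP[nG uG]].
    by rewrite !big_nil !subrr nm0 mulr0.
  have sG : {subset G <= n :: G} by move=> i iG; rewrite inE iG orbT.
  rewrite !big_cons.
  set p := \prod_(i <- G) _; set s := \sum_(i <- G) w i.
  have -> : (1 + w n) * p - 1 - (w n + s) = (p - 1 - s) + w n * (p - 1) by ring.
  rewrite [leRHS]mulrDr; apply: le_trans (nmD _ _) _; rewrite [leLHS]addrC; apply: lerD.
    by rewrite nmM mulrC ler_wpM2r ?nm_ge0// wG.
  by apply: IH => // G' uG' sG'; apply: wG => // i /sG'/sG.
have := wF F uF (fun i => id).
have := lnm (\sum_(i <- F) w i).
have := nm_sub_le (\sum_(i <- F) w i) (\prod_(i <- F) (1 + w i) - 1).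
move: P; rewrite nmC.
move: (\sum_(i <- F) nm (w i)) (\sum_(i <- F) w i) (\prod_(i <- F) (1 + w i)) S2.
by move=> s v p; lra.
Qed.

(** Since [a] is nonzero, one may divide by a partial product close to [a]; this brings all finite
    products past [N] close to 1, and the four sectors then bound the sum. *)
Lemma hasprod_neq0_summ z (a : R[i]) : a != 0 -> hasprod z a ->
  summ (fun n => nm (1 - z n)).
Proof.
rewrite -nm_gt0 => a0 za.
(* With [p] the head and [q] a tail product, [p] and [p * q] differ by less than [nm a / 16] while
   [nm p >= nm a / 2]; so [q] is within [1 / 8] of 1, as [sector_bound] demands. *)
have a32 : 0 < nm a / 32 by rewrite divr_gt0.
have [N zN] := (hasprod_nmP _ _).1 za _ a32.
pose p := \prod_(i <- iota 0 N) z i.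
have pa : nm (a - p) < nm a / 32 by apply: zN => //; exact: iota_uniq.
have p0 : nm a / 2 <= nm p.
  by have := nm_sub_le a (a - p); rewrite subKr; lra.
have tail F : uniq F -> (forall i, i \in F -> (N <= i)%N) ->
    nm (\prod_(i <- F) (1 + (z i - 1)) - 1) <= 1 / 8.
  move=> uF FN.
  have -> : \prod_(i <- F) (1 + (z i - 1)) = \prod_(i <- F) z i.
    by apply: eq_bigr => i _; rewrite addrC subrK.
  set q := \prod_(i <- F) z i.
  have : nm (a - p * q) < nm a / 32.
    rewrite /p /q -big_cat; apply: zN => [|i]; last by rewrite mem_cat => ->.
    rewrite cat_uniq iota_uniq uF andbT /=; apply/hasPn => i /FN.
    by rewrite mem_iota /= add0n -leqNgt.
  have := nm_tri a (p * q) p.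
  have -> : p * q - p = p * (q - 1) by ring.
  rewrite nmM [nm (p * q - a)]nmC => h1 h2.
  have : nm p * nm (q - 1) < nm a / 16 by lra.
  have := nm_ge0 (q - 1); nra.
pose w n := z n - 1.
pose sec (l : R[i] -> R) n := (N <= n)%N && (nm (w n) <= 2 * l (w n)).
have bound (l : R[i] -> R) M : {morph l : x y / x + y} -> (forall x, l x <= nm x) ->
    \sum_(i <- iota 0 M | sec l i) nm (w i) <= 1.
  move=> lD lnm; rewrite -big_filter.
  apply: (sector_bound lD lnm) => [G uG sG||i].
  - by apply: tail => // i /sG; rewrite mem_filter => /andP[/andP[]].
  - exact/filter_uniq/iota_uniq.
  - by rewrite mem_filter => /andP[/andP[]].
have ReD : {morph @Re R : x y / x + y} by case=> ? ? [].
have ImD : {morph @Im R : x y / x + y} by case=> ? ? [].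
have ReN : {morph (fun x => - @Re R x) : x y / x + y}.
  by move=> x y; rewrite ReD opprD.
have ImN : {morph (fun x => - @Im R x) : x y / x + y}.
  by move=> x y; rewrite ImD opprD.
have Re_le (x : R[i]) : Re x <= nm x /\ - Re x <= nm x.
  by have := Re_le_nm x; rewrite ler_norml; lra.
have Im_le (x : R[i]) : Im x <= nm x /\ - Im x <= nm x.
  by have := Im_le_nm x; rewrite ler_norml; lra.
pose b n := nm (w n) *+ sec (@Re R) n + nm (w n) *+ sec (fun x => - Re x) n +
  (nm (w n) *+ sec (@Im R) n + nm (w n) *+ sec (fun x => - Im x) n).
apply: (@summ_ev _ _ b N) => [n nN|n|].
- have w0 := nm_ge0 (w n).
  have wn := nm_le_ReIm (w n); rewrite nmC -/(w n).
  have : [|| sec (@Re R) n, sec (fun x => - Re x) n, sec (@Im R) n |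
             sec (fun x => - Im x) n].
    rewrite /sec nN /=; apply/or4P.
    have : Re (w n) <= `|Re (w n)| /\ - Re (w n) <= `|Re (w n)|.
      by rewrite -[X in _ /\ _ <= X]normrN !ler_norm.
    case: (lerP `|Im (w n)| `|Re (w n)|) => ri.
      have [r0|r0] := ger0P (Re (w n)).
        by constructor 1; move: ri wn; rewrite (ger0_norm r0); lra.
      by constructor 2; move: ri wn; rewrite (ltr0_norm r0); lra.
    have [r0|r0] := ger0P (Im (w n)).
      by constructor 3; move: ri wn; rewrite (ger0_norm r0); lra.
    by constructor 4; move: ri wn; rewrite (ltr0_norm r0); lra.
  have sec0 l := mulrn_wge0 (sec l n) w0.
  have := sec0 (@Re R); have := sec0 (fun x => - Re x).
  have := sec0 (@Im R); have := sec0 (fun x => - Im x); rewrite /b.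
  by move=> ? ? ? ? /or4P[] ->; rewrite mulr1n; lra.
- by rewrite /b !addr_ge0// mulrn_wge0// nm_ge0.
exists (1 + 1 + (1 + 1)) => M; rewrite -(big_mkord xpredT b) /index_iota subn0.
have secE l : \sum_(i <- iota 0 M) nm (w i) *+ sec l i =
    \sum_(i <- iota 0 M | sec l i) nm (w i).
  by rewrite [RHS]big_mkcond; apply: eq_bigr => i _; case: (sec l i).
rewrite !big_split /= !secE.
apply: lerD; apply: lerD; apply: bound => // x.
- exact: (Re_le x).1.
- exact: (Re_le x).2.
- exact: (Im_le x).1.
- exact: (Im_le x).2.
Qed.

End absolute_products.

(** * Inner products and equivalence of sequences *)

Section inner_product.
Variables (R : realType) (V : hilbertType R).
Implicit Types u v w : V.

Lemma innerDl u v w : inner (u + v) w = inner u w + inner v w.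
Proof. exact: linearDl. Qed.

Lemma innerDr u v w : inner w (u + v) = inner w u + inner w v.
Proof. exact: linearDr. Qed.

Lemma innerNl u v : inner (- u) v = - inner u v.
Proof. exact: linearNl. Qed.

Lemma innerNr u v : inner u (- v) = - inner u v.
Proof. exact: linearNr. Qed.

Lemma inner0l v : inner 0 v = 0.
Proof. exact: linear0l. Qed.

Lemma inner0r v : inner v 0 = 0.
Proof. exact: linear0r. Qed.

Lemma innerZl (c : R[i]) u v : inner (c *: u) v = c * inner u v.
Proof. exact: linearZl_LR. Qed.

Lemma innerC u v : inner u v = (inner v u)^*.
Proof. by rewrite [LHS]hermC /= expr0 mul1r. Qed.

Lemma innerZr (c : R[i]) u v : inner u (c *: v) = c^* * inner u v.
Proof. by rewrite innerC innerZl rmorphM /= -innerC. Qed.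

Lemma inner_suml (I : Type) (r : seq I) (f : I -> V) v :
  inner (\sum_(i <- r) f i) v = \sum_(i <- r) inner (f i) v.
Proof.
elim: r => [|i r IH]; first by rewrite !big_nil inner0l.
by rewrite !big_cons innerDl IH.
Qed.

Lemma inner_sumr (I : Type) (r : seq I) (f : I -> V) v :
  inner v (\sum_(i <- r) f i) = \sum_(i <- r) inner v (f i).
Proof.
elim: r => [|i r IH]; first by rewrite !big_nil inner0r.
by rewrite !big_cons innerDr IH.
Qed.

Lemma inner_nm u : inner u u = (nm u ^+ 2)%:C.
Proof. by rewrite inner_norm nmE rmorphXn. Qed.

Lemma Re_conj (z : R[i]) : Re (z^*) = Re z.
Proof. by case: z. Qed.

Lemma Re1B (z : R[i]) : Re (1 - z) = 1 - Re z.
Proof. by case: z. Qed.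

Lemma nm_sqD u v : nm (u + v) ^+ 2 = nm u ^+ 2 + nm v ^+ 2 + (2 : R) * Re (inner u v).
Proof.
have key (z : R[i]) : z + z^* = (2 * Re z)%:C.
  by case: z => a b; apply/eqP; rewrite eq_complex /= subrr eqxx andbT; apply/eqP; ring.
apply: complexI; rewrite -inner_nm innerDl !innerDr !inner_nm [inner v u]innerC.
rewrite !rmorphD /= -key; ring.
Qed.

Lemma nm_sqB u v : nm (u - v) ^+ 2 = nm u ^+ 2 + nm v ^+ 2 - (2 : R) * Re (inner u v).
Proof.
rewrite nm_sqD nmN innerNr -mulrN; congr (_ + _ * _).
by case: (inner u v).
Qed.

Lemma inner_CS u v : nm (inner u v) <= nm u * nm v.
Proof.
have [->|v0] := eqVneq v 0; first by rewrite inner0r !nm0 mulr0.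
have v2 : 0 < nm v ^+ 2 by rewrite exprn_gt0// nm_gt0.
have c2 : inner u v * (inner u v)^* = (nm (inner u v) ^+ 2)%:C.
  by rewrite rmorphXn /= -nmE normCK.
have := sqr_ge0 (nm ((nm v ^+ 2)%:C *: u - inner u v *: v)).
rewrite nm_sqB !nmZ nm_real ger0_norm ?sqr_ge0// innerZl innerZr.
rewrite [_^* * _]mulrC c2 -rmorphM /= => h.
rewrite -(@ler_pXn2r _ 2) ?nnegrE ?mulr_ge0 ?nm_ge0// exprMn.
rewrite -(ler_pM2l v2); move: h.
move: (nm v) (nm u) (nm (inner u v)) => a b c; nra.
Qed.

Lemma inner_cvg (T : Type) (F : set_system T) {FF : Filter F} (f g : T -> V) u v :
  f @ F --> u -> g @ F --> v -> inner (f t) (g t) @[t --> F] --> (inner u v : R[i]^o).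
Proof.
move=> fu gv; apply/(@cvg_nmP R R[i]^o) => e e0.
pose C := nm u + nm v + 1.
have C0 : 0 < C by rewrite ltr_wpDl// addr_ge0// nm_ge0.
have e2 : 0 < e / 2 / C by rewrite !divr_gt0.
have [/cvg_nmP f1 /cvg_nmP g1] := (fu, gv).
have := f1 1 ltr01; have := f1 _ e2; have := g1 _ e2.
apply: filterS3 => t ge fe f1'.
have -> : inner u v - inner (f t) (g t) = inner (u - f t) v + inner (f t) (v - g t).
  by rewrite innerDl innerDr innerNl innerNr addrA subrK.
have fC : nm (f t) <= C.
  have := nm_sub_le (f t) u; rewrite nmC /C; have := nm_ge0 v; lra.
have vC : nm v <= C by rewrite /C; have := nm_ge0 u; lra.
rewrite (le_lt_trans (nmD _ _))// [e]splitr ltrD//.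
  rewrite (le_lt_trans (inner_CS _ _))//.
  by rewrite (le_lt_trans (ler_wpM2l (nm_ge0 _) vC))// -ltr_pdivlMr.
rewrite (le_lt_trans (inner_CS _ _))// (le_lt_trans (ler_wpM2r (nm_ge0 _) fC))//.
by rewrite mulrC -ltr_pdivlMr.
Qed.

(** Expand [|f t - u|^2]. Convergence of tensors is thereby reduced to two limits of scalar
    products, without a uniform estimate over test vectors. *)
Lemma cvg_inner_sub (T : Type) (F : set_system T) {FF : Filter F} (f : T -> V) u :
  inner (f t) (f t) @[t --> F] --> (inner u u : R[i]^o) ->
  inner (f t) u @[t --> F] --> (inner u u : R[i]^o) -> f @ F --> u.
Proof.
move=> /(@cvg_nmP R R[i]^o) ff /(@cvg_nmP R R[i]^o) fu; apply/cvg_nmP => e e0.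
have e4 : 0 < e ^+ 2 / 4 by rewrite divr_gt0// exprn_gt0.
have := fu _ e4; have := ff _ e4; apply: filterS2 => t ft ut.
rewrite -(@ltr_pXn2r _ 2) ?nnegrE ?nm_ge0 ?ltW// nm_sqB [inner u _]innerC Re_conj.
have := Re_le_nm (inner u u - inner (f t) (f t)).
have := Re_le_nm (inner u u - inner (f t) u).
rewrite !inner_nm -rmorphB /= !ler_norml.
have -> : Re ((nm u ^+ 2)%:C - inner (f t) u) = nm u ^+ 2 - Re (inner (f t) u).
  by case: (inner (f t) u).
move: ft ut; rewrite !inner_nm -rmorphB /=; lra.
Qed.

Lemma inner_eq0 u : (forall v, inner u v = 0) -> u = 0.
Proof.
move=> /(_ u); rewrite inner_nm => /complexI/eqP.
by rewrite expf_eq0 /= nm_eq0 => /eqP.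
Qed.

End inner_product.

Section equivalence.
Variables (R : realType) (H : nat -> hilbertType R).
Implicit Types f g h y : forall n, H n.

(* Equivalence of sequences; [eqv h h] says that [h] is a C_0-sequence. *)
Definition eqv f g := summ (fun n => nm (1 - inner (f n) (g n))).

Lemma eqv_sym f g : eqv f g -> eqv g f.
Proof.
apply: summ_le => n; rewrite innerC -[1 in leLHS](rmorph1 Num.conj) -rmorphB.
by rewrite /nm norm_conjC.
Qed.

(** [|f - g|^2] equals [(|f|^2 - 1) + (|g|^2 - 1)] plus twice the real part of [1 - <f, g>]. Only
    the squares are summable, not the distances. *)
Lemma eqv_dist f g : eqv f f -> eqv g g -> eqv f g ->
  summ (fun n => nm (f n - g n) ^+ 2).
Proof.
move=> ff gg fg; apply: (summ_le _ (summD (summD ff gg) (summZ (ler0n _ 2) fg))) => n.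
rewrite nm_sqB.
have := Re_le_nm (1 - inner (f n) (g n)).
have := Re_le_nm (1 - inner (f n) (f n)).
have := Re_le_nm (1 - inner (g n) (g n)).
rewrite !Re1B !inner_nm !ler_norml /=.
lra.
Qed.

(* [|<f - g, g - h>|] is at most the summable [|f - g|^2 + |g - h|^2]. *)
Lemma eqv_trans g f h : eqv f f -> eqv g g -> eqv h h -> eqv f g -> eqv g h -> eqv f h.
Proof.
move=> ff gg hh fg gh.
have fg2 := eqv_dist ff gg fg; have gh2 := eqv_dist gg hh gh.
have := summD (summD fg gh) (summD gg (summD fg2 gh2)); apply: summ_le => n.
have -> : 1 - inner (f n) (h n) =
  (1 - inner (f n) (g n)) + (1 - inner (g n) (h n)) - (1 - inner (g n) (g n)) +
    inner (f n - g n) (g n - h n).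
  by rewrite innerDl !innerDr !innerNl !innerNr; ring.
apply: le_trans (nmD _ _) _.
have := nmB (1 - inner (f n) (g n) + (1 - inner (g n) (h n))) (1 - inner (g n) (g n)).
have := nmD (1 - inner (f n) (g n)) (1 - inner (g n) (h n)).
have := inner_CS (f n - g n) (g n - h n).
move: (nm_ge0 (f n - g n)) (nm_ge0 (g n - h n)).
move: (nm (f n - g n)) (nm (g n - h n)) => a b a0 b0.
have : a * b <= a ^+ 2 + b ^+ 2 by nra.
lra.
Qed.

(** In [|1 - |h|^2| = |1 - |h|| * (1 + |h|)] the last factor is at least 1; conversely it is
    bounded, because summability bounds [|h n|]. *)
Lemma eqv_self h : eqv h h <-> summ (fun n => `|1 - nm (h n)|).
Proof.
have E n : nm (1 - inner (h n) (h n)) = `|1 - nm (h n)| * (1 + nm (h n)).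
  have h0 := nm_ge0 (h n).
  rewrite inner_nm -rmorphB nm_real -[1 + nm _]ger0_norm ?addr_ge0//.
  by rewrite -normrM; congr (`| _ |); ring.
split=> hs.
  apply: summ_le hs => n; rewrite E ler_peMr//.
  by rewrite lerDl nm_ge0.
have [|B B0 hB] := summ_bounded _ hs; first by [].
apply: (summ_le _ (summZ (_ : 0 <= 2 + B) hs)) => [n|]; last by rewrite addr_ge0.
rewrite E mulrC ler_wpM2r//.
have := hB n; have := ler_norm (nm (h n) - 1); rewrite distrC; lra.
Qed.

Lemma C_seqP h : C_seq h <-> exists a : R, hasprod (fun n => nm (h n)) a.
Proof.
split=> [[a /uncond_prodP ha]|[a ha]].
  exists (nm (a : R[i])); have := hasprod_nm ha.
  by under eq_fun do rewrite nm_nm.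
exists (a%:C); apply/uncond_prodP.
under eq_fun do rewrite nmE.
exact/hasprod_real.
Qed.

Lemma eqv_self_nm h : eqv h h -> summ (fun n => nm (1 - (nm (h n))%:C : R[i])).
Proof.
by move=> /eqv_self; apply: summ_le => n; rewrite -rmorphB nm_real.
Qed.

Lemma hasprod_ge0 (r : nat -> R) p : (forall n, 0 <= r n) -> hasprod r p -> 0 <= p.
Proof.
move=> r0 rp; apply: (cvgr_to_ge rp).
by exists 0%N => F _ _ /=; apply: prodr_ge0.
Qed.

Lemma eqv_hasprod_nm h : eqv h h -> exists a : R, hasprod (fun n => nm (h n)) a.
Proof.
move=> /eqv_self_nm/summ_hasprod[a [/hasprod_nm ha _]]; exists (nm (a : R[i])).
by move: ha; under eq_fun do rewrite nm_real ger0_norm ?nm_ge0//.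
Qed.

Lemma eqv_C_seq h : eqv h h -> C_seq h.
Proof. by move=> /eqv_hasprod_nm/C_seqP. Qed.

Lemma C0_seqP h : C0_seq h <-> eqv h h.
Proof.
rewrite /C0_seq summable_from1P eqv_self; split=> [[_]|hs].
  by apply: summ_le => n; rewrite nmE -rmorphB nm_real.
split; first exact/eqv_C_seq/eqv_self.
by apply: summ_le hs => n; rewrite nmE -rmorphB nm_real.
Qed.

Lemma C0_equivP h f : C0_equiv h f <-> eqv h f.
Proof. exact: summable_from1P. Qed.

Lemma eqv_ev f g f' g' N :
  (forall n, (N <= n)%N -> f n = f' n /\ g n = g' n) -> eqv f' g' -> eqv f g.
Proof.
move=> fg; apply: (summ_ev (N := N)) => [n /fg[-> ->] //|n]; exact: nm_ge0.
Qed.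

End equivalence.

Section more_products.
Variable R : realType.
Implicit Types (z : nat -> R[i]) (G : seq nat).

Lemma hasprod_finite (K : numFieldType) (d : nat -> K) G : uniq G ->
  hasprod (fun n => if n \in G then d n else 1) (\prod_(i <- G) d i).
Proof.
move=> uG; apply/cvgrPdist_lt => e e0.
exists (\max_(i <- G) i.+1)%N => F uF sF /=.
rewrite (@big_uniq_sub _ _ G F)//; last first.
  move=> i iG; apply: sF; rewrite mem_iota /= add0n.
  exact: (leq_bigmax_seq (F := fun j => j.+1)).
rewrite big_filter [X in _ * X]big1 ?mulr1 => [|i /negbTE -> //].
rewrite (_ : \prod_(i <- G) (if _ then _ else _) = \prod_(i <- G) d i).
  by rewrite subrr normr0.
by apply: eq_big_seq => i ->.
Qed.

Lemma hasprod_slot z z' (a : R[i]) N : hasprod z a -> z N = 1 ->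
  (forall n, n != N -> z' n = z n) -> hasprod z' (z' N * a).
Proof.
move=> za zN z'z.
have := hasprodM (@hasprod_finite _ z' [:: N] isT) za.
rewrite big_seq1; congr (hasprod _ _); apply/funext => n.
by rewrite inE; case: eqVneq => [->|nN]; rewrite ?zN ?mulr1// mul1r z'z.
Qed.

End more_products.

(** * Elementary tensors *)

Section schur.
Variables (R : realType) (V : hilbertType R) (m : nat) (G : 'I_m -> 'I_m -> R[i]).
Implicit Types (c : 'I_m -> R[i]) (v : 'I_m -> V).
Hypothesis G_ge0 : forall c, 0 <= \sum_i \sum_j c i * (c j)^* * G i j.

(* Schur's product theorem; projecting away one vector of the Gram matrix at a
   time writes it as a sum of rank-one matrices. *)
Lemma schur_product c v : 0 <= \sum_i \sum_j c i * (c j)^* * G i j * inner (v i) (v j).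
Proof.
suff H k : forall v, (forall i : 'I_m, (k <= i)%N -> v i = 0) ->
    0 <= \sum_i \sum_j c i * (c j)^* * G i j * inner (v i) (v j).
  by apply: (H m) => i; rewrite leqNgt ltn_ord.
elim: k {v} => [v v0|k IH v vk].
  rewrite big1// => i _; rewrite big1// => j _.
  by rewrite v0// inner0l mulr0.
have [km|mk] := ltnP k m; last first.
  by apply: IH => i ki; have := leq_ltn_trans ki (ltn_ord i); rewrite ltnNge mk.
pose v0 := v (Ordinal km).
have [v00|v00] := eqVneq v0 0.
  apply: IH => i; rewrite leq_eqVlt => /predU1P[ki|]; last exact: vk.
  by rewrite -[RHS]v00; congr v; apply: val_inj.
have n0 : (nm v0)%:C != 0 :> R[i].
  by rewrite (inj_eq (@complexI R)) nm_eq0.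
pose b i := inner (v i) v0 / (nm v0)%:C.
pose w i := v i - (b i / (nm v0)%:C) *: v0.
have nC : ((nm v0)%:C : R[i])^* = (nm v0)%:C.
  exact: conjc_real (nm v0).
have bE i : inner (v i) v0 = b i * (nm v0)%:C by rewrite divfK.
have bE' i : inner v0 (v i) = (b i)^* * (nm v0)%:C.
  by rewrite innerC bE rmorphM /= nC.
have vw i j : inner (v i) (v j) = inner (w i) (w j) + b i * (b j)^*.
  rewrite /w innerDl !innerDr !innerNl !innerNr !innerZl !innerZr bE bE' inner_nm.
  rewrite rmorphM /= fmorphV /= nC rmorphXn /=; field.
  by rewrite n0.
(* The rank-one part is the form of [G] at the coefficients [c i * b i], nonnegative by hypothesis.
   The projected vectors [w] vanish from index [k] on, so the induction hypothesis applies to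
   them. *)
rewrite (_ : \sum_i _ = \sum_i \sum_j c i * (c j)^* * G i j * inner (w i) (w j) +
    \sum_i \sum_j (c i * b i) * (c j * b j)^* * G i j).
  rewrite addr_ge0 ?G_ge0//; apply: IH => i ki.
  rewrite /w /b; have [ik|ik] := eqVneq (i : nat) k.
    have -> : v i = v0 by congr v; apply: val_inj.
    rewrite inner_nm rmorphXn /= expr2 mulfK// divff// scale1r subrr//.
  have -> : v i = 0 by apply: vk; rewrite ltn_neqAle eq_sym ik.
  by rewrite inner0l !mul0r scale0r subrr.
rewrite -big_split; apply: eq_bigr => i _; rewrite -big_split; apply: eq_bigr => j _ /=.
rewrite vw; move: (inner (w i) (w j)) (b i) (b j) => x b1 b2; rewrite rmorphM /=; ring.
Qed.

End schur.

Section tensors.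
Variables (R : realType) (H : nat -> hilbertType R) (K : complete_tensor_product H).
Implicit Types f g h : forall n, H n.

Lemma qprodE (z : nat -> R[i]) a : hasprod z a -> qprod z = a.
Proof.
move=> za; apply: (@hasprod_unique _ z) => //; apply/uncond_prodP.
by rewrite /qprod; apply: (@xgetI _ 0 [set a | uncond_prod z a] a); apply/uncond_prodP.
Qed.

(** The default value of [qprod] is 0, so a nonzero value is a genuine limit. *)
Lemma qprod_neq0 (z : nat -> R[i]) : qprod z != 0 -> hasprod z (qprod z).
Proof.
by rewrite /qprod; case: xgetP => [a _ /uncond_prodP//|_]; rewrite eqxx.
Qed.

(* The elementary tensor of any sequence; [0] if it is not a C-sequence. *)
Definition tens h : K :=
  if pselect (C_seq h) is left p then tensor K (exist _ h p) else 0.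

Lemma tensorE (h : Cseqs H) : tensor K h = tens (sval h).
Proof.
rewrite /tens; case: pselect => [p|/(_ (proj2_sig h))//]; case: h p => h q p /=.
by congr tensor; apply: eq_exist.
Qed.

Lemma tensorEs h p : tensor K (exist _ h p) = tens h.
Proof. exact: tensorE. Qed.

Lemma tens_inner h f a : C_seq h -> C_seq f ->
  hasprod (fun n => inner (h n) (f n)) a -> inner (tens h) (tens f) = a.
Proof.
move=> hC fC ha; rewrite -(tensorEs hC) -(tensorEs fC) /tensor ctp_emb_inner.
exact: qprodE.
Qed.

Lemma tens_hasprod h f : inner (tens h) (tens f) != 0 ->
  hasprod (fun n => inner (h n) (f n)) (inner (tens h) (tens f)).
Proof.
rewrite {1 3}/tens; case: pselect => [p|_]; last by rewrite inner0l eqxx.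
rewrite {1 2}/tens; case: pselect => [q|_]; last by rewrite inner0r eqxx.
by rewrite /tensor ctp_emb_inner => /qprod_neq0.
Qed.

Lemma eqv_tens h f : eqv h h -> eqv f f -> eqv h f ->
  hasprod (fun n => inner (h n) (f n)) (inner (tens h) (tens f)).
Proof.
move=> hh ff /(@summ_hasprod R (fun n => inner (h n) (f n)))[a [hfa _]].
by rewrite (tens_inner (eqv_C_seq hh) (eqv_C_seq ff) hfa).
Qed.

Lemma tens_nm h : C_seq h -> hasprod (fun n => nm (h n)) (nm (tens h)).
Proof.
move=> hC; have /C_seqP[a ha] := hC.
have a0 : 0 <= a by apply: hasprod_ge0 ha => n; exact: nm_ge0.
suff -> : nm (tens h) = a by [].
have : hasprod (fun n => inner (h n) (h n)) ((a ^+ 2)%:C : R[i]).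
  under eq_fun do rewrite inner_nm.
  by apply/hasprod_real; rewrite expr2; exact: hasprodM.
move=> /(tens_inner hC hC); rewrite inner_nm => /complexI.
by move/eqP; rewrite eqrXn2 ?nm_ge0// => /eqP.
Qed.

Definition mix (P : pred nat) f g : forall n, H n := fun n => if P n then f n else g n.

Lemma eqv_mix P f g f' g' : eqv f f' -> eqv g g' -> eqv (mix P f g) (mix P f' g').
Proof.
move=> ff gg; apply: summ_le (summD ff gg) => n; rewrite /mix.
by case: (P n); rewrite ?lerDl ?lerDr nm_ge0.
Qed.

Lemma mix_id P f : mix P f f = f.
Proof. by apply/functional_extensionality_dep => n; rewrite /mix if_same. Qed.

Lemma mix_outside (F : seq nat) f g n : (\max_(i <- F) i.+1 <= n)%N ->
  mix (fun n => n \in F) f g n = g n.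
Proof.
move=> nF; rewrite /mix ifF//; apply/negbTE; apply: contraL nF => nF.
by rewrite -ltnNge; apply: (leq_bigmax_seq (F := fun j => j.+1)).
Qed.

Lemma eqv_mixl P f g h : eqv f h -> eqv g h -> eqv (mix P f g) h.
Proof. by move=> fh gh; rewrite -(mix_id P h); exact: eqv_mix. Qed.

(** Both scalar limits required by [cvg_inner_sub] are limits of mixed products, the tails being
    those of [inner (g n) (g n)] and of [inner (g n) (f n)]. *)
Lemma tens_approx f g : eqv f f -> eqv g g -> eqv f g ->
  (fun F : seq nat => tens (mix (fun n => n \in F) f g)) @ fins --> tens f.
Proof.
move=> ff gg fg; have gf := eqv_sym fg.
apply: cvg_inner_sub.
  apply: (hasprod_mix ff gg); first exact: eqv_tens.
  move=> F _; have mm := eqv_mix (fun n => n \in F) ff gg.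
  have := eqv_tens mm mm mm; congr (hasprod _ _); apply/funext => n.
  by rewrite /mix /=; case: ifP.
apply: (hasprod_mix ff gf); first exact: eqv_tens.
move=> F _; have mm := eqv_mix (fun n => n \in F) ff gg.
have := eqv_tens mm ff (eqv_mixl _ ff gf); congr (hasprod _ _); apply/funext => n.
by rewrite /mix /=; case: ifP.
Qed.

(** Both squared norms are quadratic forms in [c] whose matrices are entrywise products with the
    same Gram matrix [M] of the other factors. The bound on [A N] makes the matrix [G] of
    differences in slot [N] positive semidefinite, and Schur's theorem keeps this after
    multiplication by [M]. *)
Lemma slot_bound (H_neq0 : forall n, exists x : H n, x != 0)
    (A : forall n, {linear H n -> H n}) (r : R) (N m : nat)
    (h : 'I_m -> forall n, H n) (c : 'I_m -> R[i]) :
  0 <= r -> (forall x, nm (A N x) <= r * nm x) ->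
  (forall i j, eqv (h i) (h j)) ->
  nm (\sum_i c i *: tens (fun n => if n == N then A n (h i n) else h i n)) <=
    r * nm (\sum_i c i *: tens (h i)).
Proof.
move=> r0 Ar hh; pose h' i : forall n, H n := fun n => if n == N then A n (h i n) else h i n.
have e1 n : exists x : H n, inner x x = 1.
  have [x x0] := H_neq0 n; exists ((nm x)^-1%:C *: x).
  by rewrite inner_nm nmZ nm_real ger0_norm ?invr_ge0 ?nm_ge0// mulVf ?expr1n// nm_eq0.
pose e n := projT1 (cid (e1 n)).
have ee n : inner (e n) (e n) = 1 by rewrite /e; case: cid.
(* A unit vector in slot [N] makes [M] the product over the other slots; dividing by
   [inner (h i N) (h j N)] would fail where this vanishes. *)
pose g i : forall n, H n := fun n => if n == N then e n else h i n.
have gg i j : eqv (g i) (g j).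
  apply: (eqv_ev (N := N.+1)) (hh i j) => n nN.
  by rewrite /g gtn_eqF.
have hh' i j : eqv (h' i) (h' j).
  apply: (eqv_ev (N := N.+1)) (hh i j) => n nN.
  by rewrite /h' gtn_eqF.
pose M i j := inner (tens (g i)) (tens (g j)).
have hM i j : inner (tens (h i)) (tens (h j)) = inner (h i N) (h j N) * M i j.
  apply: tens_inner; [exact: eqv_C_seq|exact: eqv_C_seq|].
  apply: (@hasprod_slot _ _ (fun n => inner (h i n) (h j n)) _ N
    (eqv_tens (gg i i) (gg j j) (gg i j))) => [|n nN].
    by rewrite /g eqxx.
  by rewrite /g (negbTE nN).
have hM' i j : inner (tens (h' i)) (tens (h' j)) =
    inner (A N (h i N)) (A N (h j N)) * M i j.
  rewrite (_ : inner (A N _) (A N _) = inner (h' i N) (h' j N)); last by rewrite /h' eqxx.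
  apply: tens_inner; [exact: eqv_C_seq|exact: eqv_C_seq|].
  apply: (@hasprod_slot _ _ (fun n => inner (h' i n) (h' j n)) _ N
    (eqv_tens (gg i i) (gg j j) (gg i j))) => [|n nN].
    by rewrite /g eqxx.
  by rewrite /g /h' (negbTE nN).
pose G i j := (r ^+ 2)%:C * inner (h i N) (h j N) - inner (A N (h i N)) (A N (h j N)).
have sq (V : hilbertType R) (d : 'I_m -> R[i]) (v : 'I_m -> V) :
    ((nm (\sum_i d i *: v i)) ^+ 2)%:C = \sum_i \sum_j d i * (d j)^* * inner (v i) (v j).
  rewrite -inner_nm inner_suml; apply: eq_bigr => i _.
  rewrite inner_sumr; apply: eq_bigr => j _; rewrite innerZl innerZr; ring.
have G0 d : 0 <= \sum_i \sum_j d i * (d j)^* * G i j.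
  have -> : \sum_i \sum_j d i * (d j)^* * G i j =
      (r ^+ 2 * nm (\sum_i d i *: h i N) ^+ 2 - nm (A N (\sum_i d i *: h i N)) ^+ 2)%:C.
    have -> : A N (\sum_i d i *: h i N) = \sum_i d i *: A N (h i N).
      by rewrite linear_sum; apply: eq_bigr => i _; rewrite linearZ.
    rewrite rmorphB rmorphM /= !sq mulr_sumr -sumrB; apply: eq_bigr => i _.
    by rewrite mulr_sumr -sumrB; apply: eq_bigr => j _; rewrite /G; ring.
  rewrite ler0c subr_ge0 -exprMn ler_pXn2r ?nnegrE ?mulr_ge0 ?nm_ge0//.
rewrite -(@ler_pXn2r _ 2) ?nnegrE ?mulr_ge0 ?nm_ge0// exprMn -subr_ge0 -ler0c.
have := schur_product G0 c (fun i => tens (g i)).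
rewrite rmorphB rmorphM /= !sq mulr_sumr -sumrB; congr (0 <= _).
apply: eq_bigr => i _; rewrite mulr_sumr -sumrB; apply: eq_bigr => j _.
by rewrite -/(h' i) -/(h' j) hM hM' /G /M; ring.
Qed.

Section incomplete.
Variable y : forall n, H n.
Hypothesis yy : eqv y y.

Local Notation E := (incomplete_tensor_product K y).

Lemma tens_in h : eqv h h -> eqv h y -> exists u : E, val u = tens h.
Proof.
move=> hh hy.
pose S := [set u | exists h : Cseqs H,
    [/\ C0_seq (sval h), C0_equiv (sval h) y & u = tensor K h]].
have hS : tens h \in closed_span S.
  apply/closed_spanP => e e0; exists (tens h); last by rewrite subrr normr0.
  exists 1%N, (fun=> 1), (fun=> tens h); split; last by rewrite big_ord1 scale1r.
  move=> _; exists (exist _ h (eqv_C_seq hh)); split.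
  - exact/C0_seqP.
  - exact/C0_equivP.
  - by rewrite tensorEs.
by exists (Sub (tens h) hS : closed_span_space S).
Qed.

Lemma ev_eqv h N : (forall n, (N <= n)%N -> h n = y n) -> eqv h h /\ eqv h y.
Proof.
by move=> hy; split; apply: (eqv_ev (N := N)) yy => n nN; rewrite hy.
Qed.

(** Density as an induction principle: general sequences equivalent to [y] are reached from finite
    modifications of [y] by [tens_approx], their span by linearity, and the rest by closure. *)
Lemma itp_ind (P : E -> Prop) :
  (forall c u v, P u -> P v -> P (c *: u + v)) ->
  (forall u, (forall e : R, 0 < e -> exists2 u', P u' & nm (u - u') < e) -> P u) ->
  (forall h N u, (forall n, (N <= n)%N -> h n = y n) -> val u = tens h -> P u) ->
  forall u, P u.
Proof.
move=> Plin Plim Pgen.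
have P0 : P 0.
  have [u uy] := tens_in yy yy.
  have Pu : P u by apply: (Pgen y 0%N).
  by have := Plin (-1) _ _ Pu Pu; rewrite scaleN1r addNr.
have PC0 h (u : E) : eqv h h -> eqv h y -> val u = tens h -> P u.
  move=> hh hy uh; apply: Plim => e e0.
  have /cvg_nmP/(_ _ e0) near_h := tens_approx hh yy hy.
  have [F [uF hF]] := filter_ex (filterI fins_uniq near_h).
  have mm := eqv_mixl (fun n => n \in F) hy yy.
  have [u' u'F] := tens_in (eqv_mix (fun n => n \in F) hh yy) mm.
  exists u'; last by rewrite /nm closed_span_normE raddfB /= uh u'F.
  apply: (Pgen (mix (fun n => n \in F) h y) (\max_(i <- F) i.+1)%N) => // n.
  exact: mix_outside.
move=> u; apply: Plim => e e0.
have eC : 0 < e%:C :> R[i] by rewrite ltcR.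
have /closed_spanP/(_ _ eC)[v [m [c [s [Ss ->]]]] uv] := valP u.
have {}Ss i : exists2 w : E, val w = s i & P w.
  have [h [/C0_seqP hh /C0_equivP hy sh]] := Ss i.
  have [w wh] := tens_in hh hy.
  by exists w; [rewrite wh sh tensorE|exact: PC0 wh].
have {}Ss i : exists w : E, val w = s i /\ P w by have [w ? ?] := Ss i; exists w.
have [w wP] := choice Ss; have ws i := (wP i).1; have Pw i := (wP i).2.
exists (\sum_i c i *: w i).
  elim/big_ind: _ => [//|u1 u2 P1 P2|i _].
    by have := Plin 1 _ _ P1 P2; rewrite scale1r.
  by have := Plin (c i) _ _ (Pw i) P0; rewrite addr0.
have sE : val (\sum_i c i *: w i) = \sum_i c i *: s i.
  by rewrite raddf_sum; apply: eq_bigr => i _; rewrite -ws.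
by rewrite -nm_lt closed_span_normE raddfB /= sE.
Qed.

End incomplete.
End tensors.

Section real_products.
Variable R : realType.
Implicit Types (r : nat -> R) (F : seq nat).

Lemma fins_iota : iota 0 @ \oo --> fins.
Proof.
move=> P [N PN]; exists N => // k /= Nk; apply: PN; first exact: iota_uniq.
by move=> i; rewrite !mem_iota /= !add0n => /leq_trans; exact.
Qed.

Lemma hasprod_neq0 (K : numFieldType) (z : nat -> K) a : a != 0 -> hasprod z a ->
  forall n, z n != 0.
Proof.
move=> a0 za n; apply: contra_neq a0 => zn; apply: (@hasprod_unique _ z) => //.
apply/cvgrPdist_lt => e e0; exists n.+1 => F _ sF /=.
have nF : n \in F by apply: sF; rewrite mem_iota /= add0n.
by rewrite (big_rem n nF) /= zn mul0r subr0 normr0.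
Qed.

Lemma hasprodV (K : numFieldType) (z : nat -> K) a : a != 0 -> hasprod z a ->
  hasprod (fun n => (z n)^-1) a^-1.
Proof.
by move=> a0 za; rewrite /hasprod; under eq_cvg do rewrite prodfV; exact: cvgV.
Qed.

Lemma summ_hasprod_real r : summ (fun n => `|1 - r n|) ->
  exists2 p, hasprod r p & (forall n, r n != 0) -> p != 0.
Proof.
move=> rs; have : summ (fun n => nm (1 - (r n)%:C : R[i])).
  by apply: summ_le rs => n; rewrite -rmorphB nm_real.
move=> /summ_hasprod[a [ra a0]].
have aE : a = (Re a)%:C.
  apply: (hasprod_unique ra); apply/hasprod_nmP => e e0.
  apply: filterS ((hasprod_nmP _ _).1 ra e e0) => F; apply: le_lt_trans.
  rewrite -rmorph_prod /= -rmorphB nm_real.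
  by move: (Re_le_nm (a - (\prod_(i <- F) r i)%:C)); case: (a).
exists (Re a); first by apply/hasprod_real; rewrite -aE.
move=> r0; rewrite -(inj_eq (@complexI R)) -aE; apply: a0 => n.
by rewrite (inj_eq (@complexI R)).
Qed.

Lemma hasprod_neq0_summ_real r p : p != 0 -> hasprod r p -> summ (fun n => `|1 - r n|).
Proof.
rewrite -(inj_eq (@complexI R)) => p0 /hasprod_real/(hasprod_neq0_summ p0).
by apply: summ_le => n; rewrite -rmorphB nm_real.
Qed.

Lemma hasprod_le r s p q : (forall n, 0 <= r n <= s n) -> hasprod r p -> hasprod s q ->
  p <= q.
Proof.
move=> rs rp sq; rewrite -subr_ge0; apply: (cvgr_to_ge (cvgB sq rp)).
by apply: nearW => F; rewrite subr_ge0; apply: ler_prod.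
Qed.

(** For factors at least 1 the product dominates 1 plus the sum of the [r i - 1], so bounded finite
    products force summability. *)
Lemma bounded_hasprod r b : (forall n, 1 <= r n) ->
  (forall F, uniq F -> \prod_(i <- F) r i <= b) -> exists2 p, hasprod r p & p <= b.
Proof.
move=> r1 rb.
have sum_le F : 1 + \sum_(i <- F) (r i - 1) <= \prod_(i <- F) r i.
  elim: F => [|n F IH]; first by rewrite !big_nil addr0.
  rewrite !big_cons; have := r1 n.
  have : 0 <= \sum_(i <- F) (r i - 1) by apply: sumr_ge0 => i _; rewrite subr_ge0.
  nra.
have : summ (fun n => `|1 - r n|).
  exists (b - 1) => N; rewrite -(big_mkord xpredT (fun n => `|1 - r n|)) /index_iota subn0.
  under eq_bigr do rewrite distrC ger0_norm ?subr_ge0//.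
  by rewrite lerBrDl (le_trans (sum_le _))// rb// iota_uniq.
move=> /summ_hasprod_real[p rp _]; exists p => //.
by apply: (cvgr_to_le rp); exists 0%N => F uF _ /=; exact: rb.
Qed.

(** Meant for operator norms, which need not be attained: the bound is checked for strictly smaller
    numbers, here [(1 - 1 / (k + 1)) * r n], and passes to the limit. *)
Lemma ler_prod_approx r b F : (forall n, 0 < r n) ->
  (forall s : nat -> R, (forall n, 0 <= s n < r n) -> \prod_(i <- F) s i <= b) ->
  \prod_(i <- F) r i <= b.
Proof.
move=> r0 sb.
have : (fun k : nat => \prod_(i <- F) ((1 - k.+1%:R^-1) * r i)) @ \oo --> \prod_(i <- F) r i.
  elim: (F) => [|n G IH].
    by under eq_cvg do rewrite big_nil; rewrite big_nil; exact: cvg_cst.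
  under eq_cvg do rewrite big_cons; rewrite big_cons; apply: cvgM => //.
  have : (1 - harmonic k) * r n @[k --> \oo] --> (1 - 0) * r n.
    by apply: cvgM; [apply: cvgB; [exact: cvg_cst|exact: cvg_harmonic]|exact: cvg_cst].
  by rewrite subr0 mul1r.
move=> /cvgr_to_le; apply; apply: nearW => k; apply: sb => n.
have k0 : 0 < k.+1%:R^-1 :> R by rewrite invr_gt0.
have k1 : k.+1%:R^-1 <= 1 :> R by rewrite invf_le1// ler1n.
by have := r0 n => rn; rewrite mulr_ge0 ?subr_ge0// ?(ltW rn)//= gtr_pMl// gtrBl.
Qed.

End real_products.

(** * Tensor products of operators *)

Section operator_norm.
Variables (R : realType) (V : hilbertType R).
Implicit Types (A : {linear V -> V}) (x : V).

Lemma bounded_nm A : bounded_near A (nbhs 0) <->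
  exists2 C : R, 0 <= C & forall x, nm (A x) <= C * nm x.
Proof.
rewrite linear_boundedP; split=> [/pinfty_ex_gt0[C C0 AC]|[C C0 AC]].
  have [C0' CE] := complex_gt0 C0.
  exists (Re C) => [|x]; first exact: ltW.
  by have := AC x; rewrite CE !nmE -rmorphM lecR.
apply: filterS (nbhs_pinfty_ge (_ : C%:C \is Num.real)) => [r Cr x|]; last first.
  by rewrite complex_real.
by rewrite (le_trans _ (ler_wpM2r _ Cr))// !nmE -rmorphM lecR.
Qed.

Lemma opnorm_has_sup A : bounded_near A (nbhs 0) ->
  has_sup [set Re `|A x| | x in [set x : V | `|x| <= 1]].
Proof.
move=> /bounded_nm[C C0 AC]; split.
  by exists (Re `|A 0|), 0 => //=; rewrite normr0.
exists C => _ [x /= x1 <-]; rewrite -/(nm (A x)) (le_trans (AC x))//.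
by rewrite ler_piMr// -nm_le.
Qed.

Lemma le_opnorm A x : bounded_near A (nbhs 0) -> nm (A x) <= opnorm A * nm x.
Proof.
move=> Ab; have [->|x0] := eqVneq x 0; first by rewrite linear0 !nm0 mulr0.
have n0 : 0 < nm x by rewrite nm_gt0.
rewrite -ler_pdivrMr//.
have -> : nm (A x) / nm x = nm (A ((nm x)^-1%:C *: x)).
  by rewrite linearZ nmZ nm_real ger0_norm ?invr_ge0 ?nm_ge0// mulrC.
apply: sup_upper_bound; first exact: opnorm_has_sup.
exists ((nm x)^-1%:C *: x) => //=.
by rewrite -[1](rmorph1 (real_complex R)) nm_le nmZ nm_real ger0_norm ?invr_ge0 ?nm_ge0// mulVf ?gt_eqF.
Qed.

Lemma opnorm_ge0 A : bounded_near A (nbhs 0) -> 0 <= opnorm A.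
Proof.
move=> Ab; apply: sup_upper_bound; first exact: opnorm_has_sup.
by exists 0; rewrite /= ?normr0// linear0 normr0.
Qed.

Lemma opnorm_gt0 A x : bounded_near A (nbhs 0) -> A x != 0 -> 0 < opnorm A.
Proof.
move=> Ab; rewrite -nm_gt0 => Ax; have := le_opnorm x Ab.
have := opnorm_ge0 Ab; rewrite le_eqVlt => /predU1P[<-|//].
by rewrite mul0r => /(lt_le_trans Ax); rewrite ltxx.
Qed.

Lemma opnorm_approx A (e : R) : bounded_near A (nbhs 0) -> e < opnorm A ->
  exists2 x, nm x <= 1 & e < nm (A x).
Proof.
move=> Ab eA; have e0 : 0 < opnorm A - e by rewrite subr_gt0.
have [_ [x /= x1 <-]] := sup_adherent e0 (opnorm_has_sup Ab).
by rewrite -/(opnorm A) subKr => ?; exists x => //; rewrite -nm_le.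
Qed.

End operator_norm.

Section extension.
Variables (R : realType) (W : hilbertType R) (G : W -> W -> Prop) (C : R).
Hypothesis C0 : 0 <= C.
Hypothesis G_lin : forall c u v u' v', G u v -> G u' v' -> G (c *: u + u') (c *: v + v').
Hypothesis G_bound : forall u v, G u v -> nm v <= C * nm u.
Hypothesis G_dense : forall u (e : R), 0 < e -> exists u' v', G u' v' /\ nm (u - u') < e.

Let cl u v := forall e : R, 0 < e ->
  exists u' v', [/\ G u' v', nm (u - u') < e & nm (v - v') < e].

Let cl_ex u : exists v, cl u v.
Proof.
have k0 (k : nat) : 0 < k.+1%:R^-1 :> R by rewrite invr_gt0.
have seqs k : exists p : W * W, G p.1 p.2 /\ nm (u - p.1) < k.+1%:R^-1.
  by have [u' [v' [? ?]]] := G_dense u (k0 k); exists (u', v').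
have [p pP] := choice seqs.
have hcvg := @cvg_harmonic R.
have small (e : R) : 0 < e -> \forall k \near \oo, nm (u - (p k).1) < e.
  move=> e0; have /cvgrPdist_lt/(_ e e0) := hcvg; apply: filterS => k.
  rewrite sub0r normrN ger0_norm ?ltW ?k0//; exact/lt_trans/(pP k).2.
have [v pv] : exists v : W, (fun k => (p k).2) @ \oo --> v.
  apply/cvg_ex; apply: cauchy_cvg; apply: cauchy_exP => e /complex_gt0[e0 ->].
  have e2 : 0 < Re e / 2 / (C + 1) by rewrite !divr_gt0// ltr_wpDl.
  have [K _ /= pK] := small _ e2; exists (p K).2; exists K => // k Kk /=.
  rewrite -ball_normE /= nm_lt.
  have := G_bound (G_lin (-1) (pP k).1 (pP K).1); rewrite !scaleN1r ![- _ + _]addrC => h.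
  rewrite (le_lt_trans h)//.
  have := nm_tri u (p K).1 (p k).1; rewrite [nm (_ - u)]nmC.
  have := pK k Kk; have := pK K (leqnn K) => a b c.
  have : nm ((p K).1 - (p k).1) < Re e / (C + 1).
    by rewrite [Re e]splitr mulrDl; apply: le_lt_trans c _; exact: ltrD.
  rewrite ltr_pdivlMr ?ltr_wpDl// => h1; rewrite (le_lt_trans _ h1)//.
  by rewrite mulrC ler_wpM2l ?nm_ge0// lerDl.
exists v => e e0.
have /cvg_nmP/(_ e e0) hv := pv.
have [k [hk hk']] := filter_ex (filterI hv (small e e0)).
by exists (p k).1, (p k).2; split => //; exact: (pP k).1.
Qed.

Let cl_bound u v : cl u v -> nm v <= C * nm u.
Proof.
move=> uv; apply/ler_addgt0Pr => e e0.
have e2 : 0 < e / (C + 1) by rewrite divr_gt0// ltr_wpDl.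
have [u' [v' [/G_bound h uu' vv']]] := uv _ e2.
have := nm_sub_le v v'; have := nm_sub_le u' u; rewrite nmC => h1 h2.
have e2E : e = e / (C + 1) * (C + 1) by rewrite divfK// gt_eqF// ltr_wpDl.
move: e2E uu' vv'; set d := e / (C + 1) => -> uu' vv'.
have : C * nm u' <= C * (nm u + d) by apply: ler_wpM2l => //; lra.
lra.
Qed.

Let cl_lin c u v u' v' : cl u v -> cl u' v' -> cl (c *: u + u') (c *: v + v').
Proof.
move=> uv uv' e e0.
have d0 : 0 < nm c + 1 by rewrite ltr_wpDl ?nm_ge0.
have e2 : 0 < e / 2 by rewrite divr_gt0.
have e3 : 0 < e / 2 / (nm c + 1) by rewrite divr_gt0.
have [a [b [ab ua vb]]] := uv _ e3; have [a' [b' [ab' ua' vb']]] := uv' _ e2.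
have small (x y x' y' : W) : nm (x - y) < e / 2 / (nm c + 1) -> nm (x' - y') < e / 2 ->
    nm (c *: x + x' - (c *: y + y')) < e.
  move=> h h'; rewrite opprD addrACA -scalerBr (le_lt_trans (nmD _ _))// [e]splitr.
  rewrite ltrD// nmZ; rewrite ltr_pdivlMr// in h; rewrite (le_lt_trans _ h)//.
  by rewrite mulrC ler_wpM2l ?nm_ge0// lerDl.
by exists (c *: a + a'), (c *: b + b'); split; [exact: G_lin|exact: small|exact: small].
Qed.

Let G_cl u v : G u v -> cl u v.
Proof. by move=> uv e e0; exists u, v; rewrite !subrr !nm0. Qed.

Let cl_unique u v v' : cl u v -> cl u v' -> v = v'.
Proof.
move=> uv uv'; have := cl_bound (cl_lin (-1) uv uv').
rewrite !scaleN1r addNr nm0 mulr0 => h; apply/esym/eqP.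
by rewrite -subr_eq0 -nm_eq0 eq_le nm_ge0 andbT addrC.
Qed.

(** [G] is a relation, because a vector may be a combination of elementary tensors in many ways.
    Applied to differences, the norm bound shows that its closure [cl] is single-valued; the same
    bound makes images of Cauchy sequences Cauchy, so [cl] is defined everywhere. *)
Lemma bounded_extension : exists B : {linear W -> W},
  (forall u, nm (B u) <= C * nm u) /\ forall u v, G u v -> B u = v.
Proof.
have [B BP] := choice cl_ex.
have Blin : linear B.
  by move=> c u v; apply: cl_unique (BP _) _; exact: cl_lin.
pose BL : {linear W -> W} := HB.pack B (GRing.isLinear.Build _ _ _ _ B Blin).
exists BL; split=> [u|u v /G_cl uv]; first exact/cl_bound/BP.
exact: cl_unique (BP u) uv.
Qed.

End extension.

Section tensor_operators.
Variables (R : realType) (H : nat -> hilbertType R) (K : complete_tensor_product H).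
Variable y : forall n, H n.
Hypothesis yy : eqv y y.
Implicit Types (f g h : forall n, H n) (A : forall n, {linear H n -> H n}).

Local Notation E := (incomplete_tensor_product K y).
Implicit Type B : {linear E -> E}.

Definition appl A h : forall n, H n := fun n => A n (h n).

Lemma is_tensor_opP A B : is_tensor_op A B <-> bounded_near B (nbhs 0) /\
  forall h (u : E), C_seq h -> val u = tens K h ->
    C_seq (appl A h) /\ val (B u) = tens K (appl A h).
Proof.
split=> -[Bb AB]; split=> // h u.
  move=> hC; rewrite -(tensorEs K hC) => /AB[Ah [AhE ->]].
  have E1 : sval Ah = appl A h by apply/functional_extensionality_dep => n; exact: AhE.
  by rewrite tensorE -E1; split => //; exact: (proj2_sig Ah).
rewrite tensorE => /(AB _ _ (proj2_sig h))[C Bu].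
by exists (exist _ _ C); split => //; rewrite tensorEs.
Qed.

Lemma nm_val (u : E) : nm u = nm (val u).
Proof. by rewrite /nm closed_span_normE. Qed.

(** The norms of the factors have a nonzero product, hence are summably close to 1. Were [h] not
    equivalent to [y], its inner products with all generators would be 0, and [u] would be
    orthogonal to the whole space, itself included. *)
Lemma itp_neq0 h (u : E) : C_seq h -> val u = tens K h -> u != 0 ->
  eqv h h /\ eqv h y.
Proof.
move=> hC uh u0.
have h0 : nm (tens K h) != 0 by rewrite -uh -nm_val nm_eq0.
have hh : eqv h h by apply/eqv_self/(hasprod_neq0_summ_real h0)/tens_nm.
split=> //; apply: contrapT => nhy; case/eqP: u0.
suff ortho v : inner u v = 0 by apply: inner_eq0.
elim/(@itp_ind _ _ K _ yy) : v => [c v w uv uw|v uv|f N v fy vf].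
- by rewrite innerDr innerZr uv uw mulr0 addr0.
- apply/eqP; rewrite -nm_eq0 eq_le nm_ge0 andbT; apply/ler_addgt0Pr => e e0.
  have d0 : 0 < nm u + 1 by rewrite ltr_wpDl ?nm_ge0.
  have [v' uv' vv'] := uv _ (divr_gt0 e0 d0); rewrite add0r.
  rewrite -(subrK v' v) innerDr uv' addr0 (le_trans (inner_CS _ _))//.
  rewrite ltr_pdivlMr// in vv'; apply: le_trans (ltW vv').
  by rewrite mulrC ler_wpM2l ?nm_ge0// lerDl.
- apply: contrapT => /eqP uv; apply: nhy; have [ff fy'] := ev_eqv yy fy.
  apply: (eqv_trans hh ff yy) => //.
  have hf : inner (tens K h) (tens K f) != 0 by rewrite -uh -vf.
  exact: hasprod_neq0_summ hf (tens_hasprod hf).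
Qed.

Lemma tensor_op_unique A A' B B' : is_tensor_op A B -> is_tensor_op A' B' ->
  (forall n x, A n x = A' n x) -> forall u, B u = B' u.
Proof.
move=> /is_tensor_opP[/bounded_nm[C C0 BC] AB] /is_tensor_opP[/bounded_nm[C' C0' BC'] AB'] AA'.
elim/(@itp_ind _ _ K _ yy) => [c u v Bu Bv|u Bu|h N u hy uh].
- by rewrite !linearP Bu Bv.
- apply/eqP; rewrite -subr_eq0 -nm_eq0 eq_le nm_ge0 andbT.
  apply/ler_addgt0Pr => e e0; rewrite add0r.
  have d0 : 0 < C + C' + 1 by rewrite ltr_wpDl ?addr_ge0.
  have [u' Bu' uu'] := Bu _ (divr_gt0 e0 d0).
  have -> : B u - B' u = B (u - u') - B' (u - u') by rewrite (linearB B) (linearB B') Bu' opprB addrA subrK.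
  rewrite (le_trans (nmB _ _))// (le_trans (lerD (BC _) (BC' _)))// -mulrDl.
  rewrite ltr_pdivlMr// in uu'; apply: le_trans (ltW uu').
  by rewrite mulrC ler_wpM2l ?nm_ge0// lerDl.
- have [hh _] := ev_eqv yy hy; have hC := eqv_C_seq hh.
  apply: val_inj; rewrite (AB _ _ hC uh).2 (AB' _ _ hC uh).2; congr tens.
  by apply/functional_extensionality_dep => n; exact: AA'.
Qed.

Lemma tensor_op_comp A A' A'' B B' B'' : is_tensor_op A B -> is_tensor_op A' B' ->
  (forall n x, A'' n x = A n (A' n x)) -> (forall u, B'' u = B (B' u)) ->
  is_tensor_op A'' B''.
Proof.
move=> /is_tensor_opP[/bounded_nm[C C0 BC] AB] /is_tensor_opP[/bounded_nm[C' C0' BC'] AB'] AE BE.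
apply/is_tensor_opP; split.
  apply/bounded_nm; exists (C * C'); first exact: mulr_ge0.
  by move=> u; rewrite BE (le_trans (BC _))// -mulrA ler_wpM2l.
move=> h u hC uh; have [hC' uh'] := AB' _ _ hC uh.
have -> : appl A'' h = appl A (appl A' h).
  by apply/functional_extensionality_dep => n; exact: AE.
by rewrite BE; exact: AB.
Qed.

Lemma tensor_op_id A B : (forall n x, A n x = x) -> (forall u, B u = u) -> is_tensor_op A B.
Proof.
move=> AE BE; apply/is_tensor_opP; split.
  by apply/bounded_nm; exists 1 => // x; rewrite BE mul1r.
move=> h u hC uh; suff -> : appl A h = h by rewrite BE.
by apply/functional_extensionality_dep => n; exact: AE.
Qed.

Section bounded_factors.
Variable A : forall n, {linear H n -> H n}.
Hypothesis Ab : forall n, bounded_near (A n) (nbhs 0).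
Let r n := opnorm (A n).

(* Some [h] eventually equal to [y] has a nonzero image.  Replacing finitely many
   [h n] by vectors on which [A n] nearly attains its norm compares the partial
   products of [opnorm (A n)] with those of [|A n (h n)| / |h n|]. *)
Lemma tensor_op_necessary B : is_tensor_op A B -> (exists u, B u != 0) ->
  [/\ forall n, exists x, A n x != 0,
      exists2 p, hasprod r p & p <= opnorm B &
      eqv (appl A y) y].
Proof.
move=> /is_tensor_opP[Bb AB] [u0 Bu0].
have [h [N [u [hy uh Bu]]]] : exists h N u,
    [/\ forall n, (N <= n)%N -> h n = y n, val u = tens K h & B u != 0].
  apply: contrapT => noh; move: Bu0; apply/negP; rewrite negbK; apply/eqP.
  elim/(@itp_ind _ _ K _ yy) : u0 => [c u v Bu Bv|u Bu|h N u hy uh].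
  - by rewrite linearP Bu Bv scaler0 addr0.
  - have /bounded_nm[C C0 BC] := Bb.
    apply/eqP; rewrite -nm_eq0 eq_le nm_ge0 andbT.
    apply/ler_addgt0Pr => e e0; rewrite add0r.
    have d0 : 0 < C + 1 by rewrite ltr_wpDl.
    have [u' Bu' uu'] := Bu _ (divr_gt0 e0 d0).
    have -> : B u = B (u - u') by rewrite linearB Bu' subr0.
    rewrite (le_trans (BC _))//.
    rewrite ltr_pdivlMr// in uu'; apply: le_trans (ltW uu').
    by rewrite mulrC ler_wpM2l ?nm_ge0// lerDl.
  - by apply: contrapT => /eqP Bu; apply: noh; exists h, N, u.
have [hh hy'] := ev_eqv yy hy; have hC := eqv_C_seq hh.
have [kC Buk] := AB _ _ hC uh.
pose k := appl A h; rewrite -/k in kC Buk.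
have [kk ky] := itp_neq0 kC Buk Bu.
have tk0 : 0 < nm (tens K k) by rewrite -Buk -nm_val nm_gt0.
have u0' : u != 0 by apply: contra_neq Bu => ->; rewrite linear0.
have th0 : 0 < nm (tens K h) by rewrite -uh -nm_val nm_gt0.
have kprod := @tens_nm _ _ K _ kC; have hprod := @tens_nm _ _ K _ hC.
have k0 n : 0 < nm (k n).
  by rewrite lt_def nm_ge0 (hasprod_neq0 (lt0r_neq0 tk0) kprod).
have h0 n : 0 < nm (h n).
  by rewrite lt_def nm_ge0 (hasprod_neq0 (lt0r_neq0 th0) hprod).
have k0' n : k n != 0 by rewrite -nm_gt0.
split; first by move=> n; exists (h n); exact: k0'.
  have r0 n : 0 < r n by apply: opnorm_gt0 (k0' n).
  pose q n := nm (k n) / nm (h n); pose b := opnorm B.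
  have q0 n : 0 < q n by rewrite divr_gt0.
  have qr n : q n <= r n by rewrite ler_pdivrMr//; exact: le_opnorm.
  pose C := nm (tens K k) / nm (tens K h).
  have C0 : 0 < C by rewrite divr_gt0.
  have rF F : uniq F -> \prod_(i <- F) r i <= b / C * \prod_(i <- F) q i.
    move=> uF; apply: ler_prod_approx => // s sr.
    have xs n : exists x : H n, nm x <= 1 /\ s n <= nm (A n x).
      have /andP[_ /(opnorm_approx (Ab n))[x x1 /ltW ?]] := sr n.
      by exists x.
    pose x n := projT1 (cid (xs n)).
    have x1 n : nm (x n) <= 1 by rewrite /x; case: cid => ? [].
    have xA n : s n <= nm (A n (x n)) by rewrite /x; case: cid => ? [].
    pose g := mix (fun n => n \in F) x h.
    have gy n : (maxn N (\max_(i <- F) i.+1) <= n)%N -> g n = y n.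
      by rewrite geq_max => /andP[Nn Fn]; rewrite /g mix_outside// hy.
    have [gg gy'] := ev_eqv yy gy; have gC := eqv_C_seq gg.
    have [w wg] := tens_in K gg gy'.
    have [agC Bw] := AB _ _ gC wg.
    have := le_opnorm w Bb; rewrite !nm_val Bw wg.
    have prodF (f1 f2 : forall n, H n) (a : R) : (forall n, 0 < nm (f1 n)) ->
        (forall n, n \notin F -> f2 n = f1 n) ->
        hasprod (fun n => nm (f1 n)) a ->
        hasprod (fun n => nm (f2 n)) (\prod_(i <- F) (nm (f2 i) / nm (f1 i)) * a).
      move=> f10 f12 f1a.
      have := hasprodM (@hasprod_finite _ (fun i => nm (f2 i) / nm (f1 i)) F uF) f1a.
      congr (hasprod _ _); apply/funext => n.
      case: (boolP (n \in F)) => nF; first by rewrite divfK// gt_eqF.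
      by rewrite mul1r f12.
    have gprod : nm (tens K g) = \prod_(i <- F) (nm (g i) / nm (h i)) * nm (tens K h).
      apply: hasprod_unique (@tens_nm _ _ K _ gC) _; apply: prodF => // n nF.
      by rewrite /g /mix (negbTE nF).
    have agprod : nm (tens K (appl A g)) =
        \prod_(i <- F) (nm (appl A g i) / nm (k i)) * nm (tens K k).
      apply: hasprod_unique (@tens_nm _ _ K _ agC) _; apply: prodF => // n nF.
      by rewrite /appl /g /mix (negbTE nF).
    pose kF := \prod_(i <- F) nm (k i); pose hF := \prod_(i <- F) nm (h i).
    have kF0 : 0 < kF by apply: prodr_gt0.
    have hF0 : 0 < hF by apply: prodr_gt0.
    (* The bound of [B] at the tensor of [g] becomes [a / kF * |tens k| <= b * (d / hF * |tens h|)].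
       Here [d <= 1], the number [a] dominates the product of [s], and [kF / hF] is the product of
       [q]. *)
    rewrite gprod agprod -/b !prodf_div -/kF -/hF.
    set a := \prod_(i <- F) nm (appl A g i); set d := \prod_(i <- F) nm (g i) => hle.
    have d1 : d <= 1.
      rewrite /d big_seq; apply: prodr_ile1 => i iF.
      by rewrite nm_ge0 /g /mix iF x1.
    have d0 : 0 <= d by apply: prodr_ge0 => i _; exact: nm_ge0.
    have sa : \prod_(i <- F) s i <= a.
      rewrite /a !big_seq; apply: ler_prod => i iF.
      by rewrite /appl /g /mix iF xA andbT; have /andP[] := sr i.
    have b0 : 0 <= b by exact: opnorm_ge0.
    apply: le_trans sa _; rewrite /C invf_div -(ler_pM2r (divr_gt0 tk0 kF0)).
    have -> : a * (nm (tens K k) / kF) = a / kF * nm (tens K k) by ring.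
    apply: le_trans hle _; rewrite [leRHS](_ : _ = b * (hF^-1 * nm (tens K h))).
      rewrite ler_wpM2l// ler_wpM2r ?(ltW th0)// ler_piMl// invr_ge0 ltW//.
    by field; rewrite !gt_eqF.
  (* Passing to the ratios gives factors at least 1, for which boundedness implies convergence;
     multiplying back by the convergent product of [q] recovers that of [r]. *)
  have rho1 n : 1 <= r n / q n by rewrite ler_pdivlMr// mul1r.
  have [|P Pprod Pb] := bounded_hasprod rho1 (b := b / C).
    move=> F uF; rewrite prodf_div ler_pdivrMr ?rF//.
    by apply: prodr_gt0.
  have qC : hasprod q C.
    have := hasprodM kprod (hasprodV (lt0r_neq0 th0) hprod).
    by [].
  exists (P * C); last by rewrite -ler_pdivlMr.
  have := hasprodM Pprod qC; congr (hasprod _ _); apply/funext => n.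
  by rewrite divfK// gt_eqF.
by apply: (eqv_ev (N := N)) ky => n nN; rewrite /k /appl hy.
Qed.

End bounded_factors.
End tensor_operators.

(** * Existence of the tensor product of operators *)

Section existence.
Variables (R : realType) (H : nat -> hilbertType R) (K : complete_tensor_product H).
Hypothesis H_neq0 : forall n, exists x : H n, x != 0.
Variable y : forall n, H n.
Hypothesis yy : eqv y y.
Implicit Types (f g h : forall n, H n).

Local Notation E := (incomplete_tensor_product K y).

Variable A : forall n, {linear H n -> H n}.
Hypothesis Ab : forall n, bounded_near (A n) (nbhs 0).
Hypothesis A_neq0 : forall n, exists x, A n x != 0.
Let r n := opnorm (A n).
Variable p : R.
Hypothesis rp : hasprod r p.
Hypothesis Ayy : eqv (appl A y) y.

Let r_gt0 n : 0 < r n.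
Proof. by have [x Ax] := A_neq0 n; exact: opnorm_gt0 Ax. Qed.

Let Ar n x : nm (A n x) <= r n * nm x.
Proof. exact: le_opnorm. Qed.

(* Only finitely many factors vanish on [y], so [p] is bounded below by a
   convergent product of the positive numbers [|<A y, y>| / |y|^2]. *)
Let p_neq0 : p != 0.
Proof.
pose s n := if inner (A n (y n)) (y n) == 0 then r n
            else nm (inner (A n (y n)) (y n)) / nm (y n) ^+ 2.
have sr n : 0 < s n <= r n.
  rewrite /s; case: eqVneq => [_|Ay0]; first by rewrite r_gt0 lexx.
  have y0 : 0 < nm (y n).
    by rewrite nm_gt0; apply: contra_neq Ay0 => ->; rewrite inner0r.
  rewrite divr_gt0 ?nm_gt0// ?exprn_gt0//= ler_pdivrMr ?exprn_gt0//.
  rewrite (le_trans (inner_CS _ _))// expr2 mulrA ler_wpM2r ?nm_ge0//.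
(* From some index on [<A y, y>] is nonzero and [|y n|^2 > 1 / 2], so that dividing by the latter
   costs the factor 2 of the estimate below. *)
have h2 : 0 < 1 / 2 :> R by lra.
have [|N1 N1P] := summ_lt _ Ayy h2; first by move=> n; exact: nm_ge0.
have [|N2 N2P] := summ_lt _ yy h2; first by move=> n; exact: nm_ge0.
have : summ (fun n => `|1 - s n|).
  apply: (summ_ev (N := maxn N1 N2)) (summZ (ler0n _ 2) (summD yy Ayy)) => [n|n].
    rewrite geq_max => /andP[/N1P + /N2P]; rewrite /appl /s.
    case: eqVneq => [->|Ay0]; first by rewrite subr0 nm1; lra.
    have := nm_sub_le 1 (inner (A n (y n)) (y n)).
    have := nm_sub_le (inner (A n (y n)) (y n)) 1; rewrite nmC nm1.
    rewrite inner_nm -rmorphB nm_real /=.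
    move: (nm (inner _ _)) (nm (1 - inner _ _)) (nm (y n) ^+ 2) => a d b h h' ad b1.
    have b0 : 1 / 2 < b by move: b1; rewrite ltr_distlC; lra.
    have bp : 0 < b by lra.
    have -> : 1 - a / b = (b - a) / b by field; rewrite gt_eqF.
    rewrite normrM normfV (gtr0_norm bp) ler_pdivrMr//.
    have ba : `|b - a| <= `|1 - b| + d.
      rewrite ler_norml; have := ler_norm (1 - b); have := ler_norm (b - 1).
      by rewrite distrC; lra.
    have := normr_ge0 (1 - b); have := normr_ge0 (b - a); nra.
  by rewrite mulr_ge0// addr_ge0// nm_ge0.
move=> /summ_hasprod_real[c sc c0].
have {}c0 : 0 < c.
  rewrite lt_def c0 => [|n]; last by have /andP[/lt0r_neq0] := sr n.
  by apply: hasprod_ge0 sc => n; have /andP[/ltW] := sr n.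
apply: lt0r_neq0; apply: lt_le_trans c0 _.
by apply: hasprod_le sc rp => n; have /andP[/ltW -> ->] := sr n.
Qed.

Let r_summ : summ (fun n => `|1 - r n|).
Proof. exact: hasprod_neq0_summ_real p_neq0 rp. Qed.

Let r_bounded : exists2 B, 0 <= B & forall n, r n <= B.
Proof.
have [|B B0 rB] := summ_bounded _ r_summ; first by [].
exists (1 + B) => [|n]; first by rewrite addr_ge0.
by have := rB n; have := ler_norm (r n - 1); rewrite distrC; lra.
Qed.

Let nm_bounded f : eqv f f -> exists2 B, 0 <= B & forall n, nm (f n) <= B.
Proof.
move=> /eqv_self fs; have [|B B0 rB] := summ_bounded _ fs; first by [].
exists (1 + B) => [|n]; first by rewrite addr_ge0.
by have := rB n; have := ler_norm (nm (f n) - 1); rewrite distrC; lra.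
Qed.

(** [|A f|] is at most [r n * |f|], and Cauchy-Schwarz against [y n] bounds it below through
    [<A f, y>]. All deviations from 1 are summable and enter with bounded coefficients. *)
Lemma appl_self f : eqv f f -> eqv (appl A f) y -> eqv (appl A f) (appl A f).
Proof.
move=> ff Afy; apply/eqv_self.
have /eqv_self fs := ff; have /eqv_self ys := yy.
have [B B0 fB] := nm_bounded ff; have [C C0 rC] := r_bounded.
have := summD (summD (summZ B0 r_summ) fs) (summD Afy (summZ (mulr_ge0 C0 B0) ys)).
apply: summ_le => n; rewrite /appl.
have := inner_CS (A n (f n)) (y n).
have := nm_sub_le 1 (1 - inner (A n (f n)) (y n)); rewrite subKr nm1.
have := Ar (f n); have := fB n; have := rC n.
have := nm_ge0 (f n); have := nm_ge0 (A n (f n)); have := ltW (r_gt0 n).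
have := nm_ge0 (1 - inner (A n (f n)) (y n)).
have : nm (A n (f n)) * (nm (y n) - 1) <= C * B * `|1 - nm (y n)|.
  apply: (@le_trans _ _ (nm (A n (f n)) * `|1 - nm (y n)|)).
    by rewrite ler_wpM2l ?nm_ge0// distrC ler_norm.
  by rewrite ler_wpM2r// (le_trans (Ar _))// ler_pM ?nm_ge0 ?(ltW (r_gt0 n)) ?rC ?fB.
have : (r n - 1) * nm (f n) <= B * `|1 - r n|.
  apply: (@le_trans _ _ (`|1 - r n| * nm (f n))).
    by rewrite ler_wpM2r ?nm_ge0// distrC ler_norm.
  by rewrite mulrC ler_wpM2r.
have := normr_ge0 (1 - nm (f n)).
have := ler_norm (nm (f n) - 1); rewrite [`|_ - 1|]distrC.
have : 0 <= B * `|1 - r n| by rewrite mulr_ge0.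
have : 0 <= C * B * `|1 - nm (y n)| by rewrite !mulr_ge0.
rewrite ler_norml.
move: (B * `|1 - r n|) (C * B * _) `|1 - nm (f n)| (nm (1 - inner _ _)).
move: (nm (inner _ _)) (nm (A n (f n))) (nm (f n)) (nm (y n)) (r n).
by move=> a b c d e x z t w *; apply/andP; split; lra.
Qed.

(* Expanding [|A (y + v)|^2 <= r^2 |y + v|^2] for [v] among [x, -x, ix, -ix]. *)
Let inner_Ax n (x : H n) : nm (inner (A n x) (A n (y n))) <=
  (r n ^+ 2 * nm (y n) ^+ 2 - nm (A n (y n)) ^+ 2) +
  r n ^+ 2 * (2 * nm (inner x (y n)) + nm x ^+ 2).
Proof.
have Q v : (2 : R) * Re (inner (A n v) (A n (y n))) <=
    (r n ^+ 2 * nm (y n) ^+ 2 - nm (A n (y n)) ^+ 2) +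
    r n ^+ 2 * (2 * nm (inner v (y n)) + nm v ^+ 2).
  have : nm (A n (v + y n)) ^+ 2 <= (r n * nm (v + y n)) ^+ 2.
    by rewrite ler_pXn2r ?nnegrE ?mulr_ge0 ?nm_ge0 ?(ltW (r_gt0 n)).
  rewrite linearD exprMn !nm_sqD.
  have := sqr_ge0 (nm (A n v)); have := sqr_ge0 (r n).
  have := Re_le_nm (inner v (y n)); rewrite ler_norml => /andP[_].
  move: (Re (inner v _)) (Re (inner (A n v) _)) => a b.
  move: (nm (inner v _)) (nm (A n v) ^+ 2) (nm v ^+ 2) (nm (y n) ^+ 2) (r n ^+ 2).
  by move=> c d e g s h1 h2 h3; nra.
have nmNx : nm (- x) = nm x by rewrite nmN.
have nmi : nm (complex.Complex 0 1 : R[i]) = 1.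
  by rewrite /nm normc_def /= expr0n expr1n add0r sqrtr1.
apply: le_trans (nm_le_ReIm _) _.
have := Q x; have := Q (- x); have := Q (complex.Complex 0 1 *: x).
have := Q (- (complex.Complex 0 1 *: x)).
rewrite !linearN /= linearZ /= !innerNl !innerZl !nmN nmZ nmM nmi !mul1r.
have -> (z : R[i]) : Re (- z) = - Re z by case: z.
have -> (z : R[i]) : Re (- z) = - Re z by case: z.
have -> (z : R[i]) : Re (complex.Complex 0 1 * z) = - Im z.
  by case: z => a b /=; rewrite mul0r mul1r sub0r.
move: (Re _) (Im _) => a b h1 h2 h3 h4.
have [a0|a0] := ger0P a; have [b0|b0] := ger0P b; lra.
Qed.

(** With [x = f n - y n], split [1 - <A f, y>] into [1 - <A y, y>], [<A x, A y - y>] and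
    [- <A x, A y>]. The second is bounded by a product of square-summable norms. The third is
    handled by [inner_Ax], whose defect [r^2 |y|^2 - |A y|^2] is summably small because [r n],
    [|y n|] and [|A y|] are summably close to 1. *)
Lemma appl_eqv f : eqv f f -> eqv f y ->
  eqv (appl A f) (appl A f) /\ eqv (appl A f) y.
Proof.
move=> ff fy; suff Afy : eqv (appl A f) y by split=> //; exact: appl_self.
have Ayself := appl_self yy Ayy.
have [B B0 yB] := nm_bounded yy; have [C C0 rC] := r_bounded.
have d1 := eqv_dist ff yy fy; have d2 := eqv_dist Ayself yy Ayy.
have C2 : 0 <= C ^+ 2 by rewrite sqr_ge0.
have BC : 0 <= (C + 1) * B ^+ 2 by rewrite mulr_ge0 ?addr_ge0 ?sqr_ge0.
have := summD (summD Ayy (summZ C0 (summD d1 d2)))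
  (summD (summD (summZ BC r_summ) (summD yy Ayself))
    (summZ C2 (summD (summZ (ler0n _ 2) (summD fy yy)) d1))).
apply: summ_le => n; rewrite /appl.
pose x := f n - y n.
have -> : 1 - inner (A n (f n)) (y n) = (1 - inner (A n (y n)) (y n)) +
    (inner (A n x) (A n (y n) - y n) - inner (A n x) (A n (y n))).
  by rewrite /x (linearB (A n)) !innerDr !innerDl !innerNr !innerNl; ring.
have r0 := ltW (r_gt0 n).
have r2C : r n ^+ 2 <= C ^+ 2 by rewrite ler_pXn2r ?nnegrE.
rewrite (le_trans (nmD _ _))// -addrA lerD2l.
apply: le_trans (nmB _ _) _; apply: lerD.
  apply: le_trans (inner_CS _ _) _.
  apply: (@le_trans _ _ (C * nm x * nm (A n (y n) - y n))).
    by rewrite ler_wpM2r ?nm_ge0// (le_trans (Ar _))// ler_wpM2r ?nm_ge0.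
  rewrite -mulrA ler_wpM2l//; move: (nm_ge0 x) (nm_ge0 (A n (y n) - y n)).
  rewrite -/x; move: (nm x) (nm (_ - _)) => a b; nra.
apply: le_trans (inner_Ax _) _; apply: lerD.
  apply: (@le_trans _ _ ((C + 1) * B ^+ 2 * `|1 - r n| +
     (`|1 - nm (y n) ^+ 2| + `|1 - nm (A n (y n)) ^+ 2|))).
    have y2 : nm (y n) ^+ 2 <= B ^+ 2 by rewrite ler_pXn2r ?nnegrE ?nm_ge0.
    have : (r n ^+ 2 - 1) * nm (y n) ^+ 2 <= (C + 1) * B ^+ 2 * `|1 - r n|.
      have -> : r n ^+ 2 - 1 = (r n - 1) * (r n + 1) by ring.
      have : (r n - 1) * ((r n + 1) * nm (y n) ^+ 2) <=
          `|1 - r n| * ((r n + 1) * nm (y n) ^+ 2).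
        apply: ler_wpM2r; last by rewrite distrC ler_norm.
        by rewrite mulr_ge0 ?sqr_ge0// addr_ge0.
      rewrite mulrA => /le_trans; apply; rewrite mulrC ler_wpM2r//.
      by rewrite ler_pM ?sqr_ge0 ?addr_ge0// lerD2r.
    have := ler_norm (nm (y n) ^+ 2 - 1); rewrite distrC.
    have := ler_norm (1 - nm (A n (y n)) ^+ 2).
    move: (r n ^+ 2) (nm (y n) ^+ 2) (nm (A n (y n)) ^+ 2) => a b c; nra.
  by rewrite !inner_nm -!rmorphB !nm_real.
apply: ler_pM => //; first exact: sqr_ge0.
  by rewrite addr_ge0 ?sqr_ge0// mulr_ge0// nm_ge0.
rewrite lerD2r ler_pM2l// /x innerDl innerNl.
have -> : inner (f n) (y n) - inner (y n) (y n) =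
   (1 - inner (y n) (y n)) - (1 - inner (f n) (y n)) by ring.
by rewrite [leRHS]addrC nmB.
Qed.

Let p_ge0 : 0 <= p.
Proof. by apply: hasprod_ge0 rp => n; exact/ltW/r_gt0. Qed.

Lemma appl_ev f N : (forall n, (N <= n)%N -> f n = y n) ->
  eqv (appl A f) (appl A f) /\ eqv (appl A f) y.
Proof. by move=> /(ev_eqv yy)[ff fy]; exact: appl_eqv. Qed.

Lemma tens_approx_iota f g : eqv f f -> eqv g g -> eqv f g ->
  (fun k => tens K (mix (fun n => (n < k)%N) f g)) @ \oo --> tens K f.
Proof.
move=> ff gg fg; have := cvg_comp _ _ (@fins_iota) (tens_approx (K := K) ff gg fg).
apply: cvg_trans; apply: near_eq_cvg; apply: nearW => k /=; congr tens.
by apply/functional_extensionality_dep => n; rewrite /mix mem_iota.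
Qed.

(* Apply the [A n] one factor at a time and let their number tend to infinity. *)
Lemma tens_bound m (h : 'I_m -> forall n, H n) (c : 'I_m -> R[i]) :
  (forall i, exists N, forall n, (N <= n)%N -> h i n = y n) ->
  nm (\sum_i c i *: tens K (appl A (h i))) <= p * nm (\sum_i c i *: tens K (h i)).
Proof.
move=> hy.
have hE i : eqv (h i) (h i) /\ eqv (h i) y by have [N /(ev_eqv yy)] := hy i.
have hA i : eqv (appl A (h i)) (appl A (h i)) /\ eqv (appl A (h i)) y.
  by have [N /appl_ev] := hy i.
have tr f g : eqv f f /\ eqv f y -> eqv g g /\ eqv g y -> eqv f g.
  by move=> [ff fy] [gg gy]; apply: (eqv_trans ff yy gg) => //; exact: eqv_sym.
pose g k i := mix (fun n => (n < k)%N) (appl A (h i)) (h i).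
have gE k i : eqv (g k i) (g k i) /\ eqv (g k i) y.
  split; first exact: eqv_mix (hA i).1 (hE i).1.
  exact: eqv_mixl (hA i).2 (hE i).2.
pose u k := \sum_i c i *: tens K (g k i).
have uS k : nm (u k.+1) <= r k * nm (u k).
  have := @slot_bound _ _ K H_neq0 A (r k) k m (g k) c (ltW (r_gt0 k)) (@Ar k).
  have -> : \sum_i c i *: tens K (fun n => if n == k then A n (g k i n) else g k i n) = u k.+1.
    apply: eq_bigr => i _; congr (_ *: tens K _); apply/functional_extensionality_dep => n.
    rewrite /g /mix; case: eqVneq => [->|nk]; first by rewrite ltnn ltnSn.
    by rewrite ltnS [(n <= k)%N]leq_eqVlt (negbTE nk).
  by apply=> i j; exact: tr.
have uk k : nm (u k) <= \prod_(n <- iota 0 k) r n * nm (\sum_i c i *: tens K (h i)).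
  elim: k => [|k IH].
    rewrite big_nil mul1r le_eqVlt; apply/orP; left; apply/eqP; congr nm.
  rewrite -addn1 iotaD big_cat big_seq1 /= addn1 add0n (le_trans (uS k))//.
  by rewrite [X in _ <= X * _]mulrC -mulrA ler_wpM2l// ltW.
have ucvg : u @ \oo --> \sum_i c i *: tens K (appl A (h i)).
  apply: cvg_big => [|i _]; first exact: add_continuous.
  apply: cvgZ; first exact: cvg_cst.
  by apply: tens_approx_iota; [exact: (hA i).1|exact: (hE i).1|exact: tr].
have pcvg : \prod_(n <- iota 0 k) r n * nm (\sum_i c i *: tens K (h i)) @[k --> \oo] -->
    p * nm (\sum_i c i *: tens K (h i)).
  by apply: cvgM; [exact: cvg_comp fins_iota rp|exact: cvg_cst].
rewrite -subr_ge0; apply: (cvgr_to_ge (cvgB pcvg (cvg_nm ucvg))).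
by apply: nearW => k; rewrite subr_ge0.
Qed.

(* [B] extends the closure of the graph spanned by the pairs [(tens f, tens (A f))]
   with [f] eventually equal to [y]. *)
Lemma tensor_op_exists : exists B : {linear E -> E},
  is_tensor_op A B /\ forall u, nm (B u) <= p * nm u.
Proof.
pose S : set (K * K) := [set uv | exists f, (exists N, forall n, (N <= n)%N -> f n = y n) /\
  uv = (tens K f, tens K (appl A f))].
pose G (u v : E) := lin_span S (val u, val v).
have G_lin c u v u' v' : G u v -> G u' v' -> G (c *: u + u') (c *: v + v').
  exact: lin_span_linear.
have G_bound u v : G u v -> nm v <= p * nm u.
  move=> [m [c [s [Ss uvE]]]]; have [h hP] := choice Ss.
  have uE : val u = \sum_i c i *: tens K (h i).
    have -> : val u = (val u, val v).1 by []; rewrite uvE (raddf_sum fst) /=.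
    by apply: eq_bigr => i _; rewrite (hP i).2.
  have vE : val v = \sum_i c i *: tens K (appl A (h i)).
    have -> : val v = (val u, val v).2 by []; rewrite uvE (raddf_sum snd) /=.
    by apply: eq_bigr => i _; rewrite (hP i).2.
  by rewrite !nm_val uE vE; apply: tens_bound => i; exact: (hP i).1.
have G_gen f N (u v : E) : (forall n, (N <= n)%N -> f n = y n) -> val u = tens K f ->
    val v = tens K (appl A f) -> G u v.
  move=> fy uf vf; exists 1%N, (fun=> 1), (fun=> (val u, val v)); split.
    by move=> _; exists f; split; [exists N|rewrite uf vf].
  by rewrite big_ord1 scale1r.
have G_dense u (e : R) : 0 < e -> exists u' v', G u' v' /\ nm (u - u') < e.
  move: e; elim/(@itp_ind _ _ K _ yy) : u => [c u v uP vP e e0|u uP e e0|f N u fy uf e e0].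
  - have e2 : 0 < e / 2 by rewrite divr_gt0.
    have d0 : 0 < nm c + 1 by rewrite ltr_wpDl ?nm_ge0.
    have [a [b [ab ua]]] := uP _ (divr_gt0 e2 d0); have [a' [b' [ab' va]]] := vP _ e2.
    exists (c *: a + a'), (c *: b + b'); split; first exact: G_lin.
    rewrite opprD addrACA -scalerBr (le_lt_trans (nmD _ _))// [e]splitr ltrD// nmZ.
    rewrite ltr_pdivlMr// in ua; rewrite (le_lt_trans _ ua)//.
    by rewrite mulrC ler_wpM2l ?nm_ge0// lerDl.
  - have e2 : 0 < e / 2 by rewrite divr_gt0.
    have [u' u'P uu'] := uP _ e2; have [a [b [ab ua]]] := u'P _ e2.
    exists a, b; split=> //; rewrite (le_lt_trans (nm_tri u' _ _))//.
    by rewrite [e]splitr ltrD.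
  - have [AA Ay'] := appl_ev fy; have [v vA] := tens_in K AA Ay'.
    by exists u, v; split; [exact: (G_gen f N)|rewrite subrr nm0].
have [B [Bp BG]] := bounded_extension p_ge0 G_lin G_bound G_dense.
exists B; split=> //; apply/is_tensor_opP; split.
  by apply/bounded_nm; exists p.
(* If the tensor vanishes, nothing relates [h] to [y]. The norm products of [A h] are then dominated
   by those of [r n * |h n|], which tend to [p * 0]. *)
move=> h u hC uh; have [u0|u0] := eqVneq u 0.
  have th0 : nm (tens K h) = 0 by rewrite -uh u0 nm0.
  have hprod := @tens_nm _ _ K _ hC; rewrite th0 in hprod.
  have Ahprod : hasprod (fun n => nm (appl A h n)) 0.
    have := hasprodM rp hprod; rewrite mulr0 => /cvgrPdist_lt rh0.
    apply/cvgrPdist_lt => e e0; have := rh0 e e0; apply: filterS => F.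
    apply: le_lt_trans; rewrite !sub0r !normrN !ger0_norm; last 2 first.
    - by apply: prodr_ge0 => i _; rewrite mulr_ge0 ?nm_ge0// ltW.
    - by apply: prodr_ge0 => i _; exact: nm_ge0.
    by apply: ler_prod => i _; rewrite nm_ge0 /appl Ar.
  have AhC : C_seq (appl A h) by apply/C_seqP; exists 0.
  split=> //; apply/esym/eqP; rewrite u0 linear0 -nm_eq0.
  by apply/eqP; apply: hasprod_unique (tens_nm AhC) Ahprod.
have [hh hy] := itp_neq0 yy hC uh u0; have [AA Ah] := appl_eqv hh hy.
have Ayself := appl_self yy Ayy.
have AhAy : eqv (appl A h) (appl A y) by apply: (eqv_trans AA yy Ayself) => //; exact: eqv_sym.
split; first exact: eqv_C_seq.
apply/eqP; rewrite -subr_eq0 -nm_eq0 eq_le nm_ge0 andbT; apply/ler_addgt0Pr => e e0.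
rewrite add0r.
have e2 : 0 < e / 2 by rewrite divr_gt0.
have p1 : 0 < p + 1 by rewrite ltr_wpDl.
have /cvg_nmP/(_ _ (divr_gt0 e2 p1)) hF := tens_approx (K := K) hh yy hy.
have /cvg_nmP/(_ _ e2) AF := tens_approx (K := K) AA Ayself AhAy.
(* One finite set serves both sides, since [A] maps the mixture of [h] and [y] to that of [A h] and
   [A y]. *)
have [F [/= hF' AF']] := filter_ex (filterI hF AF).
pose g := mix (fun n => n \in F) h y.
have gy n : (\max_(i <- F) i.+1 <= n)%N -> g n = y n by exact: mix_outside.
have [gg gy'] := ev_eqv yy gy; have [Ag Agy] := appl_ev gy.
have [u' ug] := tens_in K gg gy'; have [v' vg] := tens_in K Ag Agy.
have Bu' : B u' = v' by apply: BG; exact: (G_gen _ _ _ _ gy).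
have vE : val v' = tens K (mix (fun n => n \in F) (appl A h) (appl A y)).
  rewrite vg; congr tens; apply/functional_extensionality_dep => n.
  by rewrite /appl /g /mix; case: ifP.
rewrite (le_trans (nm_tri (val v') _ _))// [e]splitr lerD//; last first.
  by rewrite nmC vE ltW.
have -> : val (B u) - val v' = val (B (u - u')) by rewrite (linearB B) Bu' raddfB.
rewrite -nm_val (le_trans (Bp _))// nm_val raddfB /= uh ug.
rewrite ltr_pdivlMr// in hF'; apply: le_trans (ltW hF').
by rewrite mulrC ler_wpM2l ?nm_ge0// lerDl.
Qed.

End existence.

(** * Strong continuity *)

Section right_filter.
Variable R : realType.

(** The filter behind the continuity in [C0_semigroup]: one-sided at 0, two-sided at [s > 0]. *)
Definition nbp (s : R) : set_system R := within `[0, +oo[ (nbhs s).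

Global Instance nbp_filter s : Filter (nbp s).
Proof. exact: within_filter. Qed.

Lemma nbpP (s : R) (P : set R) : nbp s P <->
  exists2 d, 0 < d & forall t, 0 <= t -> `|t - s| < d -> P t.
Proof.
split=> [/nbhs_ballP[d d0 dP]|[d d0 dP]].
  exists d => // t t0 ts; apply: (dP t); last by rewrite /= in_itv /= t0.
  by rewrite -ball_normE /= distrC.
apply/nbhs_ballP; exists d => // t; rewrite -ball_normE /= in_itv /= andbT distrC => ts t0.
exact: dP.
Qed.

Lemma nbp0P (P : set R) : nbp 0 P <->
  exists2 d, 0 < d & forall t, 0 <= t -> t < d -> P t.
Proof.
rewrite nbpP; split=> -[d d0 dP]; exists d => // t t0 td; apply: dP => //.
  by rewrite subr0 ger0_norm.
by move: td; rewrite subr0 ger0_norm.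
Qed.

Lemma nbp_shift (s : R) : 0 <= s -> (fun t => s + t) @ nbp 0 --> nbp s.
Proof.
move=> s0 P /nbpP[d d0 dP]; apply/nbp0P; exists d => // t t0 td.
by apply: dP; [exact: addr_ge0|rewrite addrC addKr ger0_norm].
Qed.

Lemma near_lt (T : Type) (F : set_system T) {FF : Filter F} (P : nat -> T -> Prop) N :
  (forall n, \forall t \near F, P n t) -> \forall t \near F, forall n, (n < N)%N -> P n t.
Proof.
move=> FP; elim: N => [|N IH]; first exact: nearW.
apply: filterS2 IH (FP N) => t tP PN n; rewrite ltnS leq_eqVlt => /predU1P[->//|].
exact: tP.
Qed.

Lemma cvg_prod_ratio (K : numFieldType) (T I : Type) (F : set_system T) {FF : Filter F}
    (f g : T -> I -> K) (h : T -> K) (a b : I -> K) (c : K) (r : seq I) :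
  (forall i, f t i @[t --> F] --> a i) -> (forall i, g t i @[t --> F] --> b i) ->
  (forall i, b i != 0) -> h @ F --> c ->
  \prod_(i <- r) (f t i / g t i) * h t @[t --> F] --> \prod_(i <- r) (a i / b i) * c.
Proof.
move=> fa gb b0 hc; apply: cvgM => //; elim: r => [|i r IH].
  by under eq_cvg do rewrite big_nil; rewrite big_nil; exact: cvg_cst.
under eq_cvg do rewrite big_cons; rewrite big_cons; apply: cvgM => //.
by apply: cvgM => //; exact: cvgV.
Qed.

End right_filter.

Section mixed_tensors.
Variables (R : realType) (H : nat -> hilbertType R) (K : complete_tensor_product H).
Implicit Types (f g h : forall n, H n).

Lemma eqv_mixr f f' g g' N : eqv f f' ->
  eqv (mix (fun n => (n < N)%N) g f) (mix (fun n => (n < N)%N) g' f').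
Proof. by apply: (eqv_ev (N := N)) => n Nn; rewrite /mix ltnNge Nn. Qed.

Lemma inner_mix f f' g g' N : eqv f f -> eqv f' f' -> eqv f f' ->
  (forall n, (n < N)%N -> inner (f n) (f' n) != 0) ->
  inner (tens K (mix (fun n => (n < N)%N) g f)) (tens K (mix (fun n => (n < N)%N) g' f')) =
  \prod_(n <- iota 0 N) (inner (g n) (g' n) / inner (f n) (f' n)) *
    inner (tens K f) (tens K f').
Proof.
move=> ff ff' fff' f0; apply: tens_inner.
- by apply: eqv_C_seq; exact: eqv_mixr.
- by apply: eqv_C_seq; exact: eqv_mixr.
have := hasprodM (@hasprod_finite _ (fun n => inner (g n) (g' n) / inner (f n) (f' n)) _
  (iota_uniq 0 N)) (eqv_tens (K := K) ff ff' fff').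
congr (hasprod _ _); apply/funext => n; rewrite mem_iota /= add0n /mix.
by case: ifP => nN; rewrite ?mul1r// divfK// f0.
Qed.

(** By [inner_mix], the two limits asked by [cvg_inner_sub] are those for [tens K (f t)] times
    finitely many ratios of convergent scalars; [f0 n != 0] keeps the denominators away from 0. *)
Lemma tens_mix_cvg (X : Type) (F : set_system X) {FF : Filter F}
    (f g : X -> forall n, H n) f0 g0 N :
  (forall n, f t n @[t --> F] --> f0 n) -> (forall n, g t n @[t --> F] --> g0 n) ->
  (\forall t \near F, eqv (f t) (f t) /\ eqv (f t) f0) -> eqv f0 f0 ->
  tens K (f t) @[t --> F] --> tens K f0 -> (forall n, f0 n != 0) ->
  tens K (mix (fun n => (n < N)%N) (g t) (f t)) @[t --> F] -->
    tens K (mix (fun n => (n < N)%N) g0 f0).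
Proof.
move=> ff0 gg0 fE f0E tf f0n0.
have in0 (u : X -> forall n, H n) n : (forall n, u t n @[t --> F] --> f0 n) ->
    \forall t \near F, inner (f t n) (u t n) != 0.
  move=> uf0.
  have /(@cvg_nmP R R[i]^o) ic :
      inner (f t n) (u t n) @[t --> F] --> (inner (f0 n) (f0 n) : R[i]^o).
    exact: inner_cvg.
  have h0 : 0 < nm (inner (f0 n) (f0 n)).
    rewrite inner_nm nm_real ger0_norm ?sqr_ge0//; apply: exprn_gt0; rewrite nm_gt0; exact: f0n0.
  apply: filterS (ic _ h0) => t; apply: contraTneq => ->.
  by rewrite subr0 ltxx.
have cst n : (fun _ : X => f0 n) @ F --> f0 n by exact: cvg_cst.
have inE n : inner (f0 n) (f0 n) != 0.
  by rewrite inner_nm (inj_eq (@complexI R) _ 0) expf_eq0 /= nm_eq0 f0n0.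
apply: cvg_inner_sub.
  rewrite (inner_mix _ _ f0E f0E f0E) => [|n _]; last exact: inE.
  have nz : \forall t \near F, forall n, (n < N)%N -> inner (f t n) (f t n) != 0.
    by apply: near_lt => n; exact: in0.
  have E : \forall t \near F, \prod_(n <- iota 0 N) (inner (g t n) (g t n) / inner (f t n) (f t n)) *
      inner (tens K (f t)) (tens K (f t)) =
      inner (tens K (mix (fun n => (n < N)%N) (g t) (f t)))
            (tens K (mix (fun n => (n < N)%N) (g t) (f t))).
    by apply: filterS2 fE nz => t [ft _] nzt; rewrite inner_mix.
  apply: cvg_trans (near_eq_cvg E) _.
  by apply: cvg_prod_ratio => // *; exact: inner_cvg.
rewrite (inner_mix _ _ f0E f0E f0E) => [|n _]; last exact: inE.
have nz : \forall t \near F, forall n, (n < N)%N -> inner (f t n) (f0 n) != 0.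
  by apply: near_lt => n; exact: (in0 (fun=> f0)).
have E : \forall t \near F, \prod_(n <- iota 0 N) (inner (g t n) (g0 n) / inner (f t n) (f0 n)) *
    inner (tens K (f t)) (tens K f0) =
    inner (tens K (mix (fun n => (n < N)%N) (g t) (f t)))
          (tens K (mix (fun n => (n < N)%N) g0 f0)).
  by apply: filterS2 fE nz => t [ft ft0] nzt; rewrite inner_mix.
apply: cvg_trans (near_eq_cvg E) _.
by apply: cvg_prod_ratio => // *; apply: inner_cvg => //; exact: cvg_cst.
Qed.

End mixed_tensors.

(* Baire's theorem for a pointwise limit [f] of continuous maps [g N]: the closed
   sets where [g] is Cauchy up to [e] from [N] on cover the interval, so one of
   them has interior, where [f] is within [e] of the continuous [g N]. *)
Lemma baire_limit_osc (R : realType) (V : normedModType R[i]) (g : nat -> R -> V)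
    (f : R -> V) (s e : R) : 0 < s -> 0 < e -> (forall N, continuous (g N)) ->
  (forall t, 0 <= t <= s -> g N t @[N --> \oo] --> f t) ->
  exists t0, 0 <= t0 <= s /\
    \forall t \near t0, 0 <= t <= s /\ nm (f t - f t0) <= 3 * e.
Proof.
move=> s0 e0 gc gf.
pose C N : set R := `[0, s]%classic `&`
  \bigcap_(M in [set M | (N <= M)%N]) [set t | nm (g M t - g N t) <= e].
have Ccl N : closed (C N).
  apply: closedI; first exact: interval_closed.
  apply: closed_bigI => M _.
  apply: (@preimage_closed _ _ (fun t => nm (g M t - g N t)) [set x | x <= e]).
    by move=> t _; apply: cvg_nm; apply: cvgB; exact: gc.
  exact: closed_le.
have gfe t : 0 <= t <= s -> exists N, C N t.
  move=> ts; have e2 : 0 < e / 2 by rewrite divr_gt0.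
  have /cvg_nmP/(_ _ e2)[N _ /= Ng] := gf t ts.
  exists N; split => [|M /= NM]; first by rewrite /= in_itv.
  apply: le_trans (nm_tri (f t) _ _) _; rewrite [e]splitr.
  by apply: lerD; apply/ltW; [rewrite nmC|]; apply: Ng => /=.
have [N nd] : exists N, ~ dense (~` (C N)).
  apply: contrapT => /forallNP nd.
  have /(@Baire R R^o)/(_ `]0, s[%classic) : forall N, open (~` C N) /\ dense (~` C N).
    move=> N; split; first exact: closed_openC.
    by apply: contrapT; exact: nd.
  case=> [||t [/= ts tC]].
  - by exists (s / 2); rewrite /= in_itv /= divr_gt0// ltr_pdivrMr// ltr_pMr// ltr1n.
  - exact: interval_open.
  move: ts; rewrite in_itv /= => /andP[/ltW t0 /ltW ts].
  have tts : 0 <= t <= s by rewrite t0.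
  by have [m Cm] := gfe t tts; exact: (tC m).
have [U [U0 Uo UC]] : exists U : set R, [/\ U !=set0, open U & U `<=` C N].
  apply: contrapT => /forallNP h; apply: nd => U U0 Uo; apply: contrapT => UC.
  apply: (h U); split=> // t Ut; apply: contrapT => nCt.
  by apply: UC; exists t.
have [t0 Ut0] := U0.
have Ct t : C N t -> 0 <= t <= s /\ nm (f t - g N t) <= e.
  move=> [/=]; rewrite in_itv /= => ts tC; split=> //.
  have : (fun M => nm (g M t - g N t)) @ \oo --> nm (f t - g N t).
    by apply: cvg_nm; apply: cvgB; [exact: gf|exact: cvg_cst].
  by move=> /cvgr_to_le; apply; exists N => // M /= NM; exact: tC.
exists t0; split; first exact: (Ct _ (UC _ Ut0)).1.
have /cvg_nmP/(_ _ e0) gt0 := gc N t0.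
have Unb : nbhs t0 U by apply: open_nbhs_nbhs.
apply: filterS2 Unb gt0 => t /UC/Ct[ts ft] gt.
split=> //; have [_ ft0] := Ct _ (UC _ Ut0).
have := nm_tri (g N t) (f t) (f t0); have := nm_tri (g N t0) (g N t) (f t0).
rewrite [nm (g N t0 - f t0)]nmC [nm (g N t - g N t0)]nmC; lra.
Qed.

(** * The tensor product semigroup *)

Section tensor_semigroup.
Variables (R : realType) (H : nat -> hilbertType R) (K : complete_tensor_product H).
Hypothesis H_neq0 : forall n, exists x : H n, x != 0.
Variable y : forall n, H n.
Hypothesis yy : eqv y y.
Variable T : forall n, R -> {linear H n -> H n}.
Hypothesis T_C0 : forall n, C0_semigroup (T n).
Variables tau M : R.
Hypothesis tau_gt0 : 0 < tau.
Hypothesis M_ge1 : 1 <= M.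
Let A t n := T n t.
Hypothesis T_loc : forall t, 0 <= t <= tau -> [/\ forall n, exists x, T n t x != 0,
  exists2 p, hasprod (fun n => opnorm (T n t)) p & p <= M & eqv (appl (A t) y) y].

Local Notation E := (incomplete_tensor_product K y).

Let Tb t n : 0 <= t -> bounded_near (A t n) (nbhs 0).
Proof. move=> t0; exact: (C0_bounded (T_C0 n) t0). Qed.

Let TD s t n x : 0 <= s -> 0 <= t -> A (s + t) n x = A s n (A t n x).
Proof. by move=> s0 t0; exact: (C0_D (T_C0 n) s0 t0 x). Qed.

Let Tcont n (x : H n) s : 0 <= s -> A t n x @[t --> nbp s] --> A s n x.
Proof.
move=> s0; have /subspace_continuousP := @C0_cont _ _ _ (T_C0 n) x; apply.
by rewrite /= in_itv /= s0.
Qed.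

Let appl_loc t f : 0 <= t <= tau -> eqv f f -> eqv f y ->
  eqv (appl (A t) f) (appl (A t) f) /\ eqv (appl (A t) f) y.
Proof.
move=> tt ff fy; have [T0 [p Tp _] Ty] := T_loc tt.
by apply: (appl_eqv yy _ T0 Tp Ty) => // n; apply: Tb; have /andP[] := tt.
Qed.

Let M_ge0 : 0 <= M. Proof. exact: le_trans M_ge1. Qed.

(** The hypotheses reach only up to [tau]; beyond, [A t] is [A tau] after [A (t - tau)]. As
    [1 <= M], shorter times satisfy the bound [M ^+ k] too. *)
Lemma tensor_op_iter k t : 0 <= t <= k%:R * tau ->
  exists B : {linear E -> E}, is_tensor_op (A t) B /\ forall u, nm (B u) <= M ^+ k * nm u.
Proof.
elim: k t => [t|k IH t /andP[t0 tk]].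
  rewrite mul0r -eq_le => /eqP <-; exists (idfun : {linear E -> E}); split.
    apply: tensor_op_id => // n x; exact: (C0_0 (T_C0 n) x).
  by move=> u; rewrite expr0 mul1r.
have [ttau|ttau] := lerP t tau.
  have tt : 0 <= t <= tau by rewrite t0.
  have [T0 [p Tp pM] Ty] := T_loc tt.
  have [B [AB Bp]] := tensor_op_exists K H_neq0 yy (fun n => Tb n t0) T0 Tp Ty.
  exists B; split=> // u; rewrite (le_trans (Bp u))// ler_wpM2r ?nm_ge0//.
  by rewrite (le_trans pM)// exprS ler_peMr// exprn_ege1.
have [|B [AB BM]] := IH (t - tau).
  by rewrite subr_ge0 ltW//= lerBlDr (le_trans tk)// -natr1 mulrDl mul1r.
have tt : 0 <= tau <= tau by rewrite ltW//= lexx.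
have [T0 [p Tp pM] Ty] := T_loc tt.
have [B' [AB' Bp']] := tensor_op_exists K H_neq0 yy (fun n => Tb n (ltW tau_gt0)) T0 Tp Ty.
exists (B' \o B : {linear E -> E}); split.
  apply: tensor_op_comp AB' AB _ _ => // n x.
  by rewrite -TD ?(ltW tau_gt0)// ?subr_ge0 ?ltW// addrC subrK.
move=> u; rewrite /= (le_trans (Bp' _))// exprS -mulrA ler_pM ?nm_ge0//.
by apply: hasprod_ge0 Tp => n; apply: opnorm_ge0; exact: Tb (ltW tau_gt0).
Qed.

Let arch t : 0 <= t -> exists k, t <= k%:R * tau.
Proof.
move=> t0; exists (Num.bound (t / tau)); rewrite -ler_pdivrMr//.
by apply/ltW/archi_boundP; rewrite divr_ge0// ltW.
Qed.

Lemma tensor_op_family : exists S : R -> {linear E -> E},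
  forall t, 0 <= t -> is_tensor_op (A t) (S t).
Proof.
have h t : exists B : {linear E -> E}, 0 <= t -> is_tensor_op (A t) B; last first.
  by have [S hS] := choice h; exists S.
have [t0|t0] := lerP 0 t; last by exists (idfun : {linear E -> E}).
have [k tk] := arch t0; have [|B [AB _]] := @tensor_op_iter k t; first by rewrite t0.
by exists B.
Qed.

Variable S : R -> {linear E -> E}.
Hypothesis S_op : forall t, 0 <= t -> is_tensor_op (A t) (S t).

Lemma S_bound k t u : 0 <= t <= k%:R * tau -> nm (S t u) <= M ^+ k * nm u.
Proof.
move=> tk; have [B [AB BM]] := tensor_op_iter tk.
have t0 : 0 <= t by have /andP[] := tk.
by rewrite (tensor_op_unique yy (S_op t0) AB).
Qed.

Lemma S_bound1 t u : 0 <= t <= tau -> nm (S t u) <= M * nm u.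
Proof. by move=> tt; rewrite -[M]expr1; apply: S_bound; rewrite mul1r. Qed.

Lemma S_0 u : S 0 u = u.
Proof.
have Id : is_tensor_op (A 0) (idfun : {linear E -> E}).
  by apply: tensor_op_id => // n x; exact: (C0_0 (T_C0 n) x).
by rewrite (tensor_op_unique yy (S_op (lexx 0)) Id).
Qed.

Lemma S_D s t u : 0 <= s -> 0 <= t -> S (s + t) u = S s (S t u).
Proof.
move=> s0 t0; have comp : is_tensor_op (A (s + t)) (S s \o S t : {linear E -> E}).
  by apply: tensor_op_comp (S_op s0) (S_op t0) _ _ => // n x; exact: TD.
exact: (tensor_op_unique yy (S_op (addr_ge0 s0 t0)) comp).
Qed.

Lemma S_tens t h u : 0 <= t -> C_seq h -> val u = tens K h ->
  val (S t u) = tens K (appl (A t) h).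
Proof. by move=> t0 hC uh; have /is_tensor_opP[_ h2] := S_op t0; have [] := h2 h u hC uh. Qed.

Section nonzero_tensor.
Variables (h : forall n, H n) (N0 : nat) (u : E).
Hypothesis hy : forall n, (N0 <= n)%N -> h n = y n.
Hypothesis h_neq0 : forall n, h n != 0.
Hypothesis uh : val u = tens K h.

Let hh : eqv h h. Proof. exact: (ev_eqv yy hy).1. Qed.
Let hey : eqv h y. Proof. exact: (ev_eqv yy hy).2. Qed.

Let eqv_y f g : eqv f f /\ eqv f y -> eqv g g /\ eqv g y -> eqv f g.
Proof. by move=> [ff fy] [gg gy]; apply: (eqv_trans ff yy gg) => //; exact: eqv_sym. Qed.

Let Su t : 0 <= t -> val (S t u) = tens K (appl (A t) h).
Proof. by move=> t0; apply: S_tens => //; exact: eqv_C_seq. Qed.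

Lemma S_osc s e : 0 < s -> s <= tau -> 0 < e -> exists t0, 0 <= t0 <= s /\
  \forall t \near t0, 0 <= t <= s /\ nm (S t u - S t0 u) <= 3 * e.
Proof.
move=> s0 st e0.
(* [Num.max 0 t] extends the orbit to negative times, because [baire_limit_osc] wants continuity on
   all of [R]. *)
pose g N t := tens K (mix (fun n => (n < N)%N) (appl (A (Num.max 0 t)) h) h).
have gc N : continuous (g N).
  move=> t; pose m := Num.max 0 t.
  have m0 : 0 <= m by rewrite le_max lexx.
  have maxc : (fun t => Num.max 0 t) @ nbhs t --> nbp m.
    move=> P /nbpP[d d0 dP]; apply/nbhs_ballP; exists d => // t' tt'.
    apply: dP; first by rewrite le_max lexx.
    move: tt'; rewrite -ball_normE /= /m distrC; apply: le_lt_trans.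
    case: (leP 0 t) => t0; case: (leP 0 t') => t'0; rewrite ?subrr ?normr0//.
      by rewrite sub0r normrN [`|t' - t|]distrC !ger0_norm ?subr_ge0//; [lra|apply: le_trans t0; exact: ltW].
    by rewrite subr0 !ger0_norm ?subr_ge0//; [lra|apply: le_trans t'0; exact: ltW].
  apply: (@cvg_comp _ _ _ (fun t => Num.max 0 t)
    (fun t => tens K (mix (fun n => (n < N)%N) (appl (A t) h) h)) _ _ _ maxc).
  apply: (@tens_mix_cvg _ _ K _ _ _ (fun _ => h) (fun t => appl (A t) h)) => //.
  - by move=> n; exact: cvg_cst.
  - by move=> n; exact: Tcont.
  - exact: nearW.
  - exact: cvg_cst.
have gS t : 0 <= t <= s -> g N t @[N --> \oo] --> val (S t u).
  move=> /andP[t0 ts]; have tt : 0 <= t <= tau by rewrite t0 (le_trans ts).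
  rewrite Su// /g (max_idPr t0); have [Ah Ay] := appl_loc tt hh hey.
  by apply: tens_approx_iota => //; exact: eqv_y.
have [t0 [t0s osc]] := baire_limit_osc s0 e0 gc gS.
by exists t0.
Qed.

(** Baire gives small oscillation at some [t0 <= s] that depends on [e]. Applying [S (s - t0)]
    carries it to the right of [s] at the cost of a factor [M], whence [e / (4 * M)]. *)
Lemma S_right s : 0 < s -> s <= tau -> S (s + t) u @[t --> nbp 0] --> S s u.
Proof.
move=> s0 st; apply/cvg_nmP => e e0.
have M4 : 0 < 4 * M by rewrite mulr_gt0// (lt_le_trans _ M_ge1).
have [t0 [/andP[t00 t0s] osc]] := S_osc s0 st (divr_gt0 e0 M4).
have /nbhs_ballP[d /= d0 dP] := osc.
apply/nbp0P; exists d => // t tge0 td.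
have [|/andP[_ ts] h3] := dP (t0 + t).
  by rewrite -ball_normE /= opprD addrA subrr sub0r normrN ger0_norm.
have t0t : 0 <= t0 + t by exact: addr_ge0.
have st0 : 0 <= s - t0 by rewrite subr_ge0.
have -> : S (s + t) u = S (s - t0) (S (t0 + t) u) by rewrite -S_D// addrA subrK.
have -> : S s u = S (s - t0) (S t0 u) by rewrite -S_D// subrK.
rewrite -linearB; rewrite nmC in h3.
have st0t : 0 <= s - t0 <= tau by rewrite st0 lerBlDr (le_trans st)// lerDl.
rewrite (le_lt_trans (S_bound1 _ st0t))//.
rewrite (le_lt_trans (ler_wpM2l M_ge0 h3))//.
have -> : M * (3 * (e / (4 * M))) = 3 / 4 * e.
  by field; rewrite gt_eqF// (lt_le_trans _ M_ge1).
by rewrite gtr_pMl// ltr_pdivrMr//; lra.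
Qed.

(** From some index on [nm (1 - <A tau h, h>) < 1], so the factor is nonzero at [tau], and also
    earlier, since a vector once annihilated remains so. Continuity at 0 handles the finitely many
    other factors. *)
Lemma A_neq0_near : exists2 s0, 0 < s0 <= tau &
  forall s n, 0 <= s <= s0 -> A s n (h n) != 0.
Proof.
have tt : 0 <= tau <= tau by rewrite ltW//= lexx.
have [_ Ay] := appl_loc tt hh hey.
have Ahh : eqv (appl (A tau) h) h.
  by apply: eqv_y; [exact: appl_loc|split].
have [|N NP] := summ_lt _ Ahh (ltr01 : 0 < 1 :> R); first by move=> n; exact: nm_ge0.
have near0 n : \forall t \near nbp 0, A t n (h n) != 0.
  have /cvg_nmP := @Tcont n (h n) 0 (lexx 0).
  have -> : A 0 n (h n) = h n by exact: (C0_0 (T_C0 n) (h n)).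
  have h0 : 0 < nm (h n) by rewrite nm_gt0 h_neq0.
  by move=> /(_ _ h0); apply: filterS => t; apply: contraTneq => ->; rewrite subr0 ltxx.
have /nbp0P[d d0 dP] : \forall t \near nbp 0, forall n, (n < N)%N -> A t n (h n) != 0.
  exact: near_lt.
exists (Num.min tau (d / 2)).
  by rewrite lt_min tau_gt0 divr_gt0//= ge_min lexx.
move=> s n /andP[s0]; rewrite le_min => /andP[stau sd].
have [nN|Nn] := ltnP n N.
  by apply: dP => //; rewrite (le_lt_trans sd)// ltr_pdivrMr// ltr_pMr// ltr1n.
apply/eqP => As0; have := NP n Nn; rewrite /appl.
have -> : A tau n (h n) = 0.
  by rewrite -(subrK s tau) TD ?subr_ge0// As0 linear0.
by rewrite inner0l subr0 nm1 ltxx.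
Qed.

(* Fix a small [s].  The tensor [w] that agrees with [h] below [N] and with
   [T s h] from [N] on is close to [h] for large [N], and [S t w -> w], because its
   tail factors are those of [S (s + t) u], which is right-continuous at [s > 0]. *)
Lemma S_cvg0_tens : S t u @[t --> nbp 0] --> u.
Proof.
have [s0 /andP[s00 s0t] As0] := A_neq0_near.
(* Half of [s0], so that [s + t <= tau] for [t < s]. *)
pose s := s0 / 2.
have sgt0 : 0 < s by rewrite divr_gt0.
have ss0 : s + s = s0 by rewrite /s -splitr.
have stau : s <= tau by rewrite (le_trans _ s0t)// -ss0 lerDl ltW.
have st : 0 <= s <= tau by rewrite ltW.
have [Ash Asy] := appl_loc st hh hey.
have fE N : eqv (mix (fun n => (n < N)%N) h (appl (A s) h))
    (mix (fun n => (n < N)%N) h (appl (A s) h)) by exact: eqv_mix.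
have fy N : eqv (mix (fun n => (n < N)%N) h (appl (A s) h)) y by exact: eqv_mixl.
apply/cvg_nmP => e e0.
(* Three errors add up: [u - w], [w - S t w], and [S t w - S t u], the last amplified by at most
   [M]. *)
have M2 : 0 < M + 2 by rewrite ltr_wpDl.
have e2 : 0 < e / (M + 2) by rewrite divr_gt0.
have hs : eqv h (appl (A s) h) by apply: eqv_y.
have /cvg_nmP/(_ _ e2)[N _ /= /(_ N (leqnn N)) fN] := tens_approx_iota (K := K) hh Ash hs.
have [w wf] := tens_in K (fE N) (fy N).
have Sw t : 0 <= t -> val (S t w) =
    tens K (mix (fun n => (n < N)%N) (appl (A t) h) (appl (A (s + t)) h)).
  move=> t0; rewrite (S_tens t0 (eqv_C_seq (fE N)) wf); congr tens.
  apply/functional_extensionality_dep => n; rewrite /appl /mix; case: ifP => // _.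
  by rewrite [s + t]addrC TD// ltW.
have hA0 : h = appl (A 0) h.
  by apply/functional_extensionality_dep => n; exact/esym/(C0_0 (T_C0 n) (h n)).
have wcvg : (fun t => tens K (mix (fun n => (n < N)%N) (appl (A t) h) (appl (A (s + t)) h)))
    @ nbp 0 --> tens K (mix (fun n => (n < N)%N) h (appl (A s) h)).
  apply: tens_mix_cvg => //.
  - move=> n; apply: (@cvg_comp _ _ _ (fun t => s + t) (fun t => A t n (h n)) _ _ _
      (nbp_shift (ltW sgt0))).
    by apply: Tcont; exact: ltW.
  - by move=> n; rewrite {2}hA0; exact: Tcont.
  - apply/nbp0P; exists s => // t t0 ts.
    have tt : 0 <= s + t <= tau.
      by rewrite addr_ge0 ?(ltW sgt0)//= (le_trans _ s0t)// -ss0 lerD2l ltW.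
    have [Ath Aty] := appl_loc tt hh hey.
    by split=> //; exact: eqv_y.
  - have := S_right sgt0 stau => /cvg_nmP Sr; apply/cvg_nmP => d d0.
    have /nbp0P[c c0 Sc] := Sr d d0; apply/nbp0P; exists c => // t t0 /(Sc t t0).
    by rewrite nm_val raddfB /= !Su ?addr_ge0// ?(ltW sgt0).
  - by move=> n; apply: As0; rewrite ltW//= -ss0 lerDl ltW.
have /cvg_nmP/(_ _ e2)/nbp0P[d d0 wnear] := wcvg.
apply/nbp0P; exists (Num.min d tau); first by rewrite lt_min d0.
move=> t t0; rewrite lt_min => /andP[td ttau]; have {td}tw := wnear t t0 td.
have tt : 0 <= t <= tau by rewrite t0 ltW.
have uw : nm (u - w) < e / (M + 2) by rewrite nm_val raddfB /= uh wf.
have wSw : nm (w - S t w) < e / (M + 2) by rewrite nm_val raddfB /= Sw// wf.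
have SwSu : nm (S t w - S t u) <= M * (e / (M + 2)).
  rewrite -linearB (le_trans (S_bound1 _ tt))// ler_wpM2l// nmC ltW//.
have eE : e = (M + 2) * (e / (M + 2)) by field; rewrite gt_eqF.
rewrite eE mulrDl; move: SwSu wSw uw; set r := e / (M + 2).
have := nm_tri w u (S t u); have := nm_tri (S t w) w (S t u); lra.
Qed.

End nonzero_tensor.

Lemma S_cvg0 u : S t u @[t --> nbp 0] --> u.
Proof.
elim/(@itp_ind _ _ K _ yy) : u => [c u v Su Sv|u Su|h N u hy uh].
- have -> : (fun t => S t (c *: u + v)) = (fun t => c *: S t u + S t v).
    by apply/funext => t; rewrite linearP.
  by apply: cvgD => //; apply: cvgZ => //; exact: cvg_cst.
- apply/cvg_nmP => e e0.
  have M2 : 0 < M + 2 by rewrite ltr_wpDl.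
  have e2 : 0 < e / (M + 2) by rewrite divr_gt0.
  have [w /cvg_nmP/(_ _ e2) Sw uw] := Su _ e2.
  have /nbp0P[d d0 dP] := Sw; apply/nbp0P; exists (Num.min d tau).
    by rewrite lt_min d0.
  move=> t t0; rewrite lt_min => /andP[td ttau]; have {td}wSw := dP t t0 td.
  have tt : 0 <= t <= tau by rewrite t0 ltW.
  have SwSu : nm (S t w - S t u) <= M * (e / (M + 2)).
    by rewrite -linearB (le_trans (S_bound1 _ tt))// ler_wpM2l// nmC ltW.
  have eE : e = (M + 2) * (e / (M + 2)) by field; rewrite gt_eqF.
  rewrite eE mulrDl; move: SwSu wSw uw; set r := e / (M + 2).
  have := nm_tri w u (S t u); have := nm_tri (S t w) w (S t u); lra.
- have [h0|/existsNP[n hn]] := pselect (forall n, h n != 0).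
    exact: (S_cvg0_tens hy).
  have hn0 : h n = 0 by apply/eqP/negbNE/negP.
  have hC := eqv_C_seq (ev_eqv yy hy).1.
  have u0 : u = 0.
    apply/eqP; rewrite -nm_eq0 nm_val uh; apply: contraT => t0.
    by have := hasprod_neq0 t0 (tens_nm hC) n; rewrite hn0 nm0 eqxx.
  rewrite u0 (_ : (fun t => S t 0) = fun=> 0); first exact: cvg_cst.
  by apply/funext => t; rewrite linear0.
Qed.

Lemma S_C0 : C0_semigroup S.
Proof.
split=> [t t0|u|s t s0 t0 u|u].
- by have /is_tensor_opP[] := S_op t0.
- exact: S_0.
- exact: S_D.
apply/subspace_continuousP => t0; rewrite /= in_itv /= andbT => t00.
have [k tk] := arch (addr_ge0 t00 ler01).
(* A bound for [S] on all of [[0, t0 + 1]]: from the left, the difference is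
   [S t (S (t0 - t) u - u)], whose outer operator varies with [t]. *)
pose Q := M ^+ k.
have Q0 : 0 < Q by rewrite exprn_gt0// (lt_le_trans _ M_ge1).
apply/cvg_nmP => e e0.
have /cvg_nmP/(_ _ (divr_gt0 e0 Q0))/nbp0P[d d0 dP] := @S_cvg0 u.
apply/nbpP; exists (Num.min 1 d); first by rewrite lt_min ltr01.
move=> t tge0; rewrite lt_min => /andP[t1 td]; rewrite /from_subspace /=.
have Qb r : 0 <= r -> r <= t0 + 1 -> forall v, nm (S r v) <= Q * nm v.
  by move=> r0 r1 v; apply: S_bound; rewrite r0 (le_trans r1).
have [le_t|/ltW le_t] := lerP t0 t.
  have dt0 : 0 <= t - t0 by rewrite subr_ge0.
  have -> : S t u = S t0 (S (t - t0) u) by rewrite -S_D// addrC subrK.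
  rewrite -linearB (le_lt_trans (Qb _ t00 _ _))// ?lerDl//.
  by rewrite mulrC -ltr_pdivlMr//; apply: dP => //; rewrite -(ger0_norm dt0).
have dt0 : 0 <= t0 - t by rewrite subr_ge0.
have -> : S t0 u = S t (S (t0 - t) u) by rewrite -S_D// addrC subrK.
rewrite -linearB (le_lt_trans (Qb _ tge0 _ _))//; first by rewrite (le_trans le_t)// lerDl.
rewrite mulrC -ltr_pdivlMr// nmC; apply: dP => //.
by rewrite -(ger0_norm dt0) distrC.
Qed.

End tensor_semigroup.

(* Sokal's gliding hump: with [opnorm (T (k_j)) > 6 j 3^j], add to [x] successive
   vectors [+-w j] of norm at most [3^-j] nearly attaining that norm, with the sign
   for which the [j]-th operator does not decrease. *)
Lemma uniform_boundedness (R : realType) (V : hilbertType R) (T : nat -> {linear V -> V}) :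
  (forall k, bounded_near (T k) (nbhs 0)) ->
  (forall x, exists B, forall k, nm (T k x) <= B) ->
  exists B, forall k, opnorm (T k) <= B.
Proof.
move=> Tb Tx; apply: contrapT => /forallNP nB.
pose q j : R := 3^-1 ^+ j.
have q0 j : 0 < q j by rewrite exprn_gt0// invr_gt0.
have qS j : 3 * q j.+1 = q j by rewrite /q exprS mulrA mulfV// mul1r.
(* At the limit [l], the [j]-th operator keeps [2 / 3 * N j * q j] from its own step and loses at
   most [N j * q j / 2] to the later ones; a sixth remains, hence the 6. *)
have big j : exists k, 6 * j%:R / q j < opnorm (T k).
  have /existsNP[k /negP] := nB (6 * j%:R / q j).
  by rewrite -ltNge => ?; exists k.
have [k kP] := choice big.
pose N j := opnorm (T (k j)).
have N0 j : 0 < N j by apply: le_lt_trans (kP j); rewrite divr_ge0 ?mulr_ge0// ltW.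
have exw j : exists w, nm w <= q j /\ 2 / 3 * N j * q j <= nm (T (k j) w).
  have [|v v1 vN] := opnorm_approx (Tb (k j)) (_ : 2 / 3 * N j < N j).
    by rewrite gtr_pMl// ltr_pdivrMr// mul1r ltr_nat.
  exists ((real_complex R (q j)) *: v).
  have qj := ltW (q0 j); rewrite linearZ !nmZ nm_real ger0_norm//.
  by split; [rewrite ler_piMr|rewrite mulrC ler_wpM2l// ltW].
have [w wP] := choice exw.
pose x := fix x (j : nat) : V := if j is i.+1 then
  (if nm (T (k i) (w i)) <= nm (T (k i) (x i + w i)) then x i + w i else x i - w i) else 0.
have xS j : nm (T (k j) (w j)) <= nm (T (k j) (x j.+1)).
  rewrite /=; case: ifPn => //; rewrite -ltNge linearD linearB => h.
  have := nmB (T (k j) (x j) + T (k j) (w j)) (T (k j) (x j) - T (k j) (w j)).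
  have -> : T (k j) (x j) + T (k j) (w j) - (T (k j) (x j) - T (k j) (w j)) =
      (2 : R[i]) *: T (k j) (w j).
    by rewrite opprB addrC addrA subrK scaler_nat mulr2n.
  rewrite nmZ (_ : nm (2 : R[i]) = 2); last first.
    by rewrite (_ : (2 : R[i]) = (2 : R)%:C) ?nm_real ?ger0_norm// rmorph_nat.
  lra.
have xstep j : nm (x j.+1 - x j) <= q j.
  have [wq _] := wP j; rewrite /=; case: ifP => _; first by rewrite addrC addKr.
  by rewrite addrC addKr nmN.
have xdist i j : nm (x (i + j.+1)%N - x j.+1) <= q j / 2.
  (* The exact partial sum of the geometric series of ratio [1 / 3], so that the induction
     closes. *)
  suff : nm (x (i + j.+1)%N - x j.+1) <= q j / 2 - q (i + j)%N / 2.
    by have := q0 (i + j)%N; lra.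
  elim: i => [|i IH]; first by rewrite !add0n subrr nm0 subrr.
  rewrite !addSn; have := nm_tri (x (i + j.+1)%N) (x (i + j.+1).+1) (x j.+1).
  have := xstep (i + j.+1)%N; rewrite addnS -/x; have := qS (i + j)%N.
  by move: IH; rewrite addnS; lra.
have qcvg (e : R) : 0 < e -> exists j, q j < e.
  move=> e0; have /cvgrPdist_lt/(_ e e0)[j _ /= jP] :
      (fun n => 3^-1 ^+ n : R) @ \oo --> (0 : R).
    by apply: cvg_expr; rewrite ger0_norm ?invr_ge0// invf_lt1// ltr1n.
  by exists j; have := jP j (leqnn j); rewrite sub0r normrN ger0_norm// ltW ?q0.
have [l xl] : exists l : V, x @ \oo --> l.
  apply/cvg_ex; apply: cauchy_cvg; apply: cauchy_exP => e /complex_gt0[e0 ->].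
  have [j je] := qcvg _ e0.
  exists (x j.+1); exists j.+1 => // m /= jm; rewrite -ball_normE /= nm_lt nmC.
  rewrite -(subnK jm); apply: le_lt_trans (xdist _ _) _.
  by have := q0 j; lra.
have ldist j : nm (l - x j.+1) <= q j / 2.
  have : (fun n => nm (x n - x j.+1)) @ \oo --> nm (l - x j.+1).
    by apply: cvg_nm; apply: cvgB => //; exact: cvg_cst.
  move=> /cvgr_to_le; apply; exists j.+1 => // m /= jm.
  by rewrite -(subnK jm); exact: xdist.
have [B lB] := Tx l.
have Tl j : j%:R <= nm (T (k j) l).
  have [_ wN] := wP j; have xw := xS j.
  have := nm_sub_le (T (k j) (x j.+1)) (T (k j) (x j.+1 - l)).
  have -> : T (k j) (x j.+1) - T (k j) (x j.+1 - l) = T (k j) l by rewrite linearB subKr.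
  have Nd : nm (T (k j) (x j.+1 - l)) <= N j * (q j / 2).
    apply: le_trans (le_opnorm _ (Tb (k j))) _.
    by rewrite ler_wpM2l ?(ltW (N0 j))// nmC.
  have : 6 * j%:R < N j * q j by rewrite -ltr_pdivrMr.
  move: wN Nd; rewrite -mulrA; set d := N j * q j; rewrite mulrA -/d; lra.
have := le_trans (Tl (Num.bound B)) (lB _).
have B0 : 0 <= B by apply: le_trans (lB 0%N); exact: nm_ge0.
by rewrite leNgt (archi_boundP B0).
Qed.

(** Otherwise there are times [t k < 1 / (k + 1)] at which the norm exceeds [k]; continuity at 0
    bounds these operators pointwise, against uniform boundedness. *)
Lemma C0_semigroup_bounded (R : realType) (V : hilbertType R) (S : R -> {linear V -> V}) :
  C0_semigroup S -> exists d B : R, 0 < d /\ forall t, 0 <= t < d -> opnorm (S t) <= B.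
Proof.
move=> SC0.
have k0 (k : nat) : 0 < k.+1%:R^-1 :> R by rewrite invr_gt0.
apply: contrapT => /forallNP nd.
have bad k : exists t, 0 <= t < k.+1%:R^-1 /\ k%:R < opnorm (S t).
  have /forallNP/(_ k%:R)/not_andP[//|/existsNP[t /not_implyP[td /negP]]] := nd k.+1%:R^-1.
  by rewrite -ltNge; exists t.
have [t tP] := choice bad.
have [B SB] : exists B, forall k, opnorm (S (t k)) <= B.
  apply: uniform_boundedness => [k|x].
    by apply: (C0_bounded SC0); have [/andP[]] := tP k.
  have Sx : S r x @[r --> nbp 0] --> x.
    rewrite -[X in _ --> X](C0_0 SC0).
    have /subspace_continuousP := @C0_cont _ _ _ SC0 x; apply.
    by rewrite /= in_itv /= lexx.
  have /cvg_nmP/(_ _ ltr01)/nbp0P[d d0 dP] := Sx.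
  have /cvgrPdist_lt/(_ d d0)[N _ /= NP] := @cvg_harmonic R.
  exists (\sum_(i < N) nm (S (t i) x) + (nm x + 1)) => k.
  have [/andP[tk0 tk] _] := tP k.
  have sum0 : 0 <= \sum_(i < N) nm (S (t i) x) by apply: sumr_ge0 => i _; exact: nm_ge0.
  have [kN|Nk] := ltnP k N.
    rewrite (bigD1 (Ordinal kN))//= -addrA lerDl addr_ge0//.
      by apply: sumr_ge0 => i _; exact: nm_ge0.
    by rewrite addr_ge0// nm_ge0.
  have tkd : t k < d.
    by apply: lt_trans tk _; have := NP k Nk; rewrite sub0r normrN ger0_norm// ltW.
  have := dP (t k) tk0 tkd; rewrite nmC => h.
  have := nm_sub_le (S (t k) x) x; lra.
have [_ h] := tP (Num.bound B); have := SB (Num.bound B).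
have B0 : 0 <= B.
  apply: le_trans (SB 0%N); apply: opnorm_ge0; apply: (C0_bounded SC0).
  by have [/andP[]] := tP 0%N.
by rewrite leNgt (lt_trans (archi_boundP B0)).
Qed.

(** Only finitely many [y n] vanish. With these replaced by nonzero vectors, the product of the
    norms is absolutely convergent without zero factor, hence nonzero. *)
Lemma itp_nontrivial (R : realType) (H : nat -> hilbertType R)
    (H_neq0 : forall n, exists x : H n, x != 0) (K : complete_tensor_product H)
    (y : forall n, H n) : eqv y y ->
  exists u : incomplete_tensor_product K y, u != 0.
Proof.
move=> yy; pose e n := projT1 (cid (H_neq0 n)).
have e0 n : e n != 0 by rewrite /e; case: cid.
pose h := mix (fun n => y n == 0) e y.
have [|N NP] := summ_lt _ yy (ltr01 : 0 < 1 :> R); first by move=> n; exact: nm_ge0.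
have hy n : (N <= n)%N -> h n = y n.
  move=> Nn; rewrite /h /mix; case: eqVneq => // y0.
  by have := NP n Nn; rewrite y0 inner0l subr0 nm1 ltxx.
have h0 n : h n != 0 by rewrite /h /mix; case: ifPn.
have [hh hey] := ev_eqv yy hy.
have [u uh] := tens_in K hh hey; exists u.
have [p hp p0] := summ_hasprod_real ((eqv_self h).1 hh).
rewrite -nm_eq0 nm_val uh (hasprod_unique (tens_nm (eqv_C_seq hh)) hp).
by apply: p0 => n; rewrite nm_eq0 h0.
Qed.

Theorem proposition6p12 (R : realType) (H : nat -> hilbertType R)
    (H_neq0 : forall n, exists x : H n, x != 0)
    (K : complete_tensor_product H)
    (y : forall n, H n) (y_C0 : C0_seq y)
    (T : forall n, R -> {linear H n -> H n})
    (T_C0 : forall n, C0_semigroup (T n)) :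
  let E := incomplete_tensor_product K y in
  let a := exists S : R -> {linear E -> E},
    (forall t, 0 <= t -> is_tensor_op (fun n => T n t) (S t)) /\
    C0_semigroup S in
  let b := exists tau : R, 0 < tau /\
    exists S : R -> {linear E -> E},
      (forall t, 0 <= t <= tau ->
         is_tensor_op (fun n => T n t) (S t) /\ exists u, S t u != 0) /\
      (limf_esup (fun t => (opnorm (S t))%:E) 0^'+ < +oo)%E in
  let c := exists tau M : R, [/\ 0 < tau, 0 < M &
    forall t, 0 <= t <= tau ->
      [/\ forall n, exists x, T n t x != 0,
          exists p : R, uncond_prod (fun n => opnorm (T n t)) p /\ p <= M &
          summable_from1 (fun n => inner (T n t (y n)) (y n))]] in
  (a <-> b) /\ (b <-> c).
Proof.
move=> E a b c.
have /C0_seqP yy := y_C0.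
have Tb t n : 0 <= t -> bounded_near (T n t) (nbhs 0).
  by move=> t0; exact: (C0_bounded (T_C0 n) t0).
have ab : a -> b.
  move=> [S [S_op SC0]].
  have [d [B [d0 SB]]] := C0_semigroup_bounded SC0.
  have [u0 u00] := itp_nontrivial H_neq0 K yy.
  have Su0 : S t u0 @[t --> nbp 0] --> u0.
    rewrite -[X in _ --> X](C0_0 SC0).
    have /subspace_continuousP := @C0_cont _ _ _ SC0 u0; apply.
    by rewrite /= in_itv /= lexx.
  have nu0 : 0 < nm u0 by rewrite nm_gt0.
  have /cvg_nmP/(_ _ nu0)/nbp0P[d' d'0 dP] := Su0.
  exists (Num.min d d' / 2); split; first by rewrite divr_gt0// lt_min d0.
  exists S; split=> [t /andP[t0 td]|].
    split; first exact: S_op.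
    exists u0; have : t < d'.
      apply: le_lt_trans td _; rewrite ltr_pdivrMr// gt_min; apply/orP; right.
      by rewrite ltr_pMr// ltr1n.
    by move=> /(dP t t0); apply: contraTneq => ->; rewrite subr0 ltxx.
  apply: (@le_lt_trans _ _ B%:E); last exact: ltry.
  apply: (@le_trans _ _ (ereal_sup ((fun t => (opnorm (S t))%:E) @` `]0, d[%classic))).
    apply: ereal_inf_lbound; exists `]0, d[%classic => //.
    apply: filterS2 (nbhs_right_gt 0) (nbhs_right_lt d0) => t /= t0 td.
    by rewrite in_itv /= t0.
  apply: ge_ereal_sup => _ [t /= + <-]; rewrite in_itv /= => /andP[t0 td].
  by rewrite lee_fin SB// ltW.
have bc : b -> c.
  move=> [tau [tau0 [S [S_op Slim]]]].
  (* The limit superior is an infimum of suprema over right neighbourhoods of 0, so one of these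
     suprema is below [+oo]. *)
  have /ereal_inf_lt[_ [V V0 <-] Vsup] := Slim.
  have [B VB] : exists B : R, forall t, V t -> opnorm (S t) <= B.
    have Vb t : V t -> ((opnorm (S t))%:E <= ereal_sup ((fun t => (opnorm (S t))%:E) @` V))%E.
      by move=> Vt; apply: ereal_sup_ubound; exists t.
    move: Vsup Vb; case: (ereal_sup _) => [B _ Vb|//|_ Vb].
      by exists B => t /Vb; rewrite lee_fin.
    by exists 0 => t /Vb; rewrite leeNy_eq.
  have [d d0 dV] : exists2 d, 0 < d & forall t, 0 < t < d -> V t.
    have /nbhs_ballP[d d0 dP] := V0; exists d => // t /andP[t0 td].
    by apply: dP => //; rewrite -ball_normE /= sub0r normrN gtr0_norm.
  (* The filter [0^'+] omits 0, so the norm of [S 0] joins the maximum; 1 makes [M] positive. *)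
  pose M := Num.max (Num.max B (opnorm (S 0))) 1.
  exists (Num.min tau (d / 2)), M; split.
  - by rewrite lt_min tau0 divr_gt0.
  - by rewrite !lt_max ltr01 orbT.
  move=> t /andP[t0]; rewrite le_min => /andP[ttau td].
  have tt : 0 <= t <= tau by rewrite t0.
  have [St Su] := S_op t tt.
  have [T0 [p Tp pS] Ty] := tensor_op_necessary yy (fun n => Tb t n t0) St Su.
  split=> //; last exact/summable_from1P.
  exists p; split; first exact/uncond_prodP.
  apply: (le_trans pS); rewrite /M !le_max; move: t0; rewrite le_eqVlt => /predU1P[<-|t0].
    by rewrite lexx orbT.
  rewrite VB ?orbT//; apply: dV; rewrite t0 (le_lt_trans td)// ltr_pdivrMr//.
  by rewrite ltr_pMr// ltr1n.
have ca : c -> a.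
  move=> [tau [M [tau0 M0 TM]]].
  have M1 : 1 <= Num.max M 1 by rewrite le_max lexx orbT.
  have T_loc t : 0 <= t <= tau -> [/\ forall n, exists x, T n t x != 0,
      exists2 p, hasprod (fun n => opnorm (T n t)) p & p <= Num.max M 1 &
      eqv (appl (fun n => T n t) y) y].
    move=> /TM[T0 [p [/uncond_prodP Tp pM]] /summable_from1P Ty]; split=> //.
    by exists p => //; rewrite le_max pM.
  have [S S_op] := tensor_op_family K H_neq0 yy T_C0 tau0 M1 T_loc.
  by exists S; split=> //; exact: (S_C0 H_neq0 yy T_C0 tau0 M1 T_loc S_op).
by split; [split=> [/ab|/bc/ca]|split=> [/bc|/ca/ab]].
Qed.
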